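(* Let $M$ be a generic closed regular curve in $\mathbb{R}^2$. Then the number of cusps of the secant caustic $\mathrm{SC}(M)$ is even, and the number of inflexion points of $\mathrm{SC}(M)$ is even.
   Context: A closed regular curve $M$ is the image of a $C^\infty$ immersion $f:S^1\to\mathbb{R}^2$. A parallel pair of $M$ is a pair of points $a,b\in M$, $a\neq b$, such that the tangent lines to $M$ at $a$ and $b$ are parallel. The secant caustic is $\mathrm{SC}(M)=\mathrm{cl}\{a-b : a,b \text{ is a parallel pair of } M\}$ (closure in $\mathbb{R}^2$). A point of $M$ is an inflexion point if the signed curvature changes sign there; an undulation point is a point where the curvature vanishes without changing sign. An inflexion point $f(s_0)$ is non-degenerate if $\det(f'(s_0),f'''(s_0))\neq 0$. $M$ is parameterized in the same direction at $f(s_1)$ and $f(s_2)$ if $f'(s_1)=\alpha f'(s_2)$ with $\alpha>0$. $M$ is generic if: (i) $f$ is regular; (ii) $f$ has only non-degenerate inflexion points and no undulation points; (iii) $f$ has only transversal self-crossings; (iv) if $f(s_1),f(s_2)$ is a parallel pair then at least one of them is not an inflexion point; (v) if $f(s_1),f(s_2)$ with $s_1\neq s_2$ is a parallel pair and, for local arc length parameterizations near $s_1$ and $s_2$ chosen in the same direction, the signed curvatures at $f(s_1)$ and $f(s_2)$ are equal, then the derivatives of the curvatures with respect to arc length at these points are different. For generic $M$, the set $\Sigma=\mathrm{cl}\{(s,t)\in S^1\times S^1: s\neq t,\ \det(f'(s),f'(t))=0\}$ is a finite union of disjoint smooth closed curves, and the curves parameterized by the restrictions of $(s,t)\mapsto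 f(s)-f(t)$ to the components of $\Sigma$ are the smooth branches of $\mathrm{SC}(M)$. A singular point of a parameterized curve is a cusp if, up to diffeomorphic changes of the parameter and of the plane, the curve is $t\mapsto(t^2,t^3)$ there. Inflexion points of $\mathrm{SC}(M)$ are the regular points of the branches at which the curvature of the branch changes sign. Cusps and inflexion points are counted along the parameterized branches. *)

(* Defs.v *)
From HB Require Import structures.
From mathcomp Require Import all_boot all_order all_algebra finmap.
From mathcomp Require Import all_classical all_reals all_analysis.
Import Order.TTheory GRing.Theory Num.Theory.
Import numFieldNormedType.Exports.

Set Implicit Arguments.
Unset Strict Implicit.
Unset Printing Implicit Defensive.

Local Open Scope ring_scope.
Local Open Scope classical_set_scope.

(* The circle is R / Z: functions on it are 1-periodic functions on R, and
   subsets of the torus are Z^2-invariant subsets of R * R, whose points are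
   counted in the fundamental domain [0, 1[ * [0, 1[. *)

Section Smoothness.
Context {R : realType} {V W : normedModType R}.

Definition iterD (vs : seq V) (F : V -> W) : V -> W :=
  foldr (fun v G x => 'D_v G x) F vs.

(* All iterated directional derivatives are Frechet differentiable on U; for U
   open and V of finite dimension this is C^oo (differentiability also gives
   the continuity of the iterated derivatives). *)
Definition smooth_on (U : set V) (F : V -> W) : Prop :=
  forall (vs : seq V) (x : V), U x -> differentiable (iterD vs F) x.

End Smoothness.

Definition local_diffeo {R : realType} {V : normedModType R} (a : V)
    (F : V -> V) : Prop :=
  exists (U : set V) (G : V -> V),
    [/\ open U, U a, smooth_on U F, open (F @` U) &
        smooth_on (F @` U) G /\ forall x, U x -> G (F x) = x].

Section PlaneCurves.
Context {R : realType}.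
Implicit Types (u v : R * R) (g : R -> R * R) (k : R -> R) (s t : R).

Definition det2 u v : R := u.1 * v.2 - u.2 * v.1.

(* The canonical norm of the product type R * R is the sup norm. *)
Definition enorm u : R := Num.sqrt (u.1 ^+ 2 + u.2 ^+ 2).

Definition curvature g t : R :=
  det2 (g^`() t) (g^`(2) t) / enorm (g^`() t) ^+ 3.

Definition changes_sign k t : Prop :=
  ((\forall x \near t^'-, k x < 0) /\ (\forall x \near t^'+, 0 < k x)) \/
  ((\forall x \near t^'-, 0 < k x) /\ (\forall x \near t^'+, k x < 0)).

Definition inflexion g t : Prop := changes_sign (curvature g) t.

Definition undulation g t : Prop :=
  curvature g t = 0 /\ ~ changes_sign (curvature g) t.

Definition same_direction u v : Prop :=
  exists2 alpha : R, 0 < alpha & u = alpha *: v.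

Definition distinct_on_circle s t : Prop := s - t \isn't a Num.int.

Definition parallel_pair g s t : Prop :=
  g s <> g t /\ det2 (g^`() s) (g^`() t) = 0.

(* g \o phi is a parameterization by arc length of g near s = phi 0. *)
Definition arclength_change g s (phi : R -> R) : Prop :=
  phi 0 = s /\
  exists U : set R, [/\ open U, U 0, smooth_on U phi &
    forall x, U x -> enorm ((g \o phi)^`() x) = 1].

Definition cusp g t : Prop :=
  g^`() t = 0 /\
  exists (h : R -> R) (Phi : R * R -> R * R),
    [/\ local_diffeo t h, h t = 0, local_diffeo (g t) Phi &
        \forall x \near t, Phi (g x) = (h x ^+ 2, h x ^+ 3)].

End PlaneCurves.

Section SecantCaustic.
Context {R : realType}.
Variable f : R -> R * R.

Definition closed_smooth_curve : Prop :=
  smooth_on setT f /\ forall t, f (t + 1) = f t.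

Record generic : Prop := Generic {
  generic_regular : forall t, f^`() t != 0 ;
  generic_inflexion : forall t, inflexion f t -> det2 (f^`() t) (f^`(3) t) != 0 ;
  generic_undulation : forall t, ~ undulation f t ;
  generic_crossing : forall s t, distinct_on_circle s t -> f s = f t ->
    det2 (f^`() s) (f^`() t) != 0 ;
  generic_parallel : forall s t, parallel_pair f s t ->
    ~ inflexion f s \/ ~ inflexion f t ;
  generic_curvature : forall s t, distinct_on_circle s t ->
    parallel_pair f s t ->
    forall phi psi : R -> R,
      arclength_change f s phi -> arclength_change f t psi ->
      same_direction ((f \o phi)^`() 0) ((f \o psi)^`() 0) ->
      curvature (f \o phi) 0 = curvature (f \o psi) 0 ->
      (curvature (f \o phi))^`() 0 <> (curvature (f \o psi))^`() 0
}.

Definition Sigma : set (R * R) :=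
  closure [set p | distinct_on_circle p.1 p.2 /\
                   det2 (f^`() p.1) (f^`() p.2) = 0].

(* gamma is a regular smooth parameterization, near p = gamma 0, of the
   connected component of p in Sigma. Components are taken in R * R, the
   universal cover of the torus, which does not change them locally. *)
Definition local_parameterization (p : R * R) (gamma : R -> R * R) : Prop :=
  gamma 0 = p /\
  exists2 e : R, 0 < e &
    let I := [set x : R | - e < x < e] in
    [/\ smooth_on I gamma,
        forall x, I x -> gamma^`() x != 0,
        {in I &, injective gamma} &
        exists2 U : set (R * R), open U &
          connected_component Sigma p `&` U = gamma @` I].

Definition secant (p : R * R) : R * R := f p.1 - f p.2.

(* The two properties below do not depend on the choice of the regular
   parameterization gamma of the branch through p. *)
Definition branch_cusp (p : R * R) : Prop :=
  Sigma p /\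
  exists2 gamma, local_parameterization p gamma & cusp (secant \o gamma) 0.

Definition branch_inflexion (p : R * R) : Prop :=
  Sigma p /\
  exists2 gamma, local_parameterization p gamma &
    (secant \o gamma)^`() 0 != 0 /\ inflexion (secant \o gamma) 0.

Definition torus_points (P : R * R -> Prop) : set (R * R) :=
  [set p | [/\ 0 <= p.1 < 1, 0 <= p.2 < 1 & P p]].

Definition SC_cusps : set (R * R) := torus_points branch_cusp.

Definition SC_inflexions : set (R * R) := torus_points branch_inflexion.

End SecantCaustic.

Definition finite_even {T : choiceType} (A : set T) : Prop :=
  finite_set A /\ ~~ odd #|` fset_set A|%fset.

(* Main.v *)
Require Import Defs.
From mathcomp Require Import all_boot all_order all_algebra finmap.
From mathcomp Require Import all_classical all_reals all_analysis.
From mathcomp Require Import ring lra.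

Import Order.TTheory GRing.Theory Num.Theory.
Import numFieldNormedType.Exports.

Set Implicit Arguments.
Unset Strict Implicit.
Unset Printing Implicit Defensive.

Local Open Scope ring_scope.
Local Open Scope classical_set_scope.

(** Exchanging the ends of a chord, (s, t) |-> (t, s), maps Sigma to itself and
    replaces f s - f t by its opposite.  So it permutes the cusps of the
    branches, and also their inflexion points; off the diagonal it has no fixed
    point, and there both kinds of points come in pairs (even_swap).  What is
    left is the diagonal.

    By Rolle's theorem applied to the tangent direction (short_parallel_pair),
    a diagonal point of Sigma is a pair (s, s) where f has an inflexion, and two
    nearby points with parallel tangents lie on opposite sides of s
    (near_diagonal).  Along the branch the two ends therefore move in opposite
    directions (diagonal_speeds), so the secant has nonzero velocity and there
    is no cusp.  On the other hand the branch turns with the tangents at the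
    ends, and these pass the inflexion of f: the branch has an inflexion at
    (s, s), for every inflexion f s (diagonal_branch_inflexion).
    Hence the diagonal contributes as many inflexions as f has, and this number
    is even, because on a closed curve the curvature alternately increases and
    decreases through its zeros (even_periodic_zeros).

    The branch through (s, s) has to be constructed.  The slope of the tangent
    line has a nondegenerate critical point at an inflexion, so it is a constant
    plus or minus the square of a smooth coordinate h (fold_coordinate, from
    Hadamard's lemma).  The parallel pairs near (s, s) are then those with
    opposite values of h, and x |-> (h^-1 x, h^-1 (- x)) parameterizes them.

    Finiteness is local.  Along a branch the velocity of the secant is parallel
    to the tangents at both ends.  It can vanish only where the signed
    curvatures at the ends agree (singular_branch), and its direction turns with
    the tangent of f, so that the branch can inflect only where f does, at one
    of the ends (inflexion_branch).  The genericity conditions isolate both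
    kinds of pairs: for the first kind, the condition on the derivatives of the
    curvatures is the nonvanishing of the Jacobian of the two equations
    (transversality, singular_pairs_isolated).  Compactness of the square
    concludes (finite_of_isolated). *)

(** * Smooth functions on the line *)

Section SmoothFunctions.
Context {R : realType}.
Implicit Types (U V : set R) (F G H : R -> R).

(** The derivative is a witness G rather than derive1 F, whose values outside U are
    arbitrary: closure properties are then plain inductions. *)
Fixpoint Cn n U F : Prop :=
  if n is m.+1 then
    exists2 G, (forall x, U x -> is_derive x 1 F (G x)) & Cn m U G
  else True.

Definition Cinf U F : Prop := forall n, Cn n U F.

Lemma Cn_le n U F : Cn n.+1 U F -> Cn n U F.
Proof.
elim: n F => //= n IH F [G dG [H dH cH]].
by exists G => //; apply: IH; exists H.
Qed.

Lemma Cn_sub n U V F : V `<=` U -> Cn n U F -> Cn n V F.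
Proof.
move=> VU; elim: n F => //= n IH F [G dG cG].
by exists G; [move=> x /VU; exact: dG|exact: IH].
Qed.

Lemma Cinf_sub U V F : V `<=` U -> Cinf U F -> Cinf V F.
Proof. by move=> VU cF n; exact: Cn_sub VU (cF n). Qed.

Lemma is_derive_eq_on U F G x d : open U -> U x ->
  (forall y, U y -> F y = G y) -> is_derive x 1 F d -> is_derive x 1 G d.
Proof.
move=> oU Ux FG; apply: near_eq_is_derive.
by apply: filterS (open_nbhs_nbhs (conj oU Ux)) => y; exact: FG.
Qed.

Lemma Cn_eq n U F G : open U -> (forall x, U x -> F x = G x) ->
  Cn n U F -> Cn n U G.
Proof.
move=> oU FG; case: n => //= n [H dH cH]; exists H => // x Ux.
exact: is_derive_eq_on oU Ux FG (dH x Ux).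
Qed.

Lemma Cinf_is_derive U F x : Cinf U F -> U x -> is_derive x 1 F (F^`() x).
Proof.
move=> cF Ux; have [G dG _] := cF 1; have := dG x Ux.
by rewrite derive1E => -[dF _]; exact: DeriveDef.
Qed.

Lemma Cinf_derivable U F x : Cinf U F -> U x -> derivable F x 1.
Proof. by move=> cF Ux; have [] := Cinf_is_derive cF Ux. Qed.

Lemma Cinf_continuous U F x : Cinf U F -> U x -> {for x, continuous F}.
Proof.
move=> cF Ux; apply: differentiable_continuous.
by apply/derivable1_diffP; exact: Cinf_derivable cF Ux.
Qed.

Lemma Cinf_derive1 U F : open U -> Cinf U F -> Cinf U F^`().
Proof.
move=> oU cF n; have [G dG cG] := cF n.+1; apply: Cn_eq cG => // x Ux.
by have [_ <-] := dG x Ux; rewrite derive1E.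
Qed.

Lemma Cinf_derive1n n U F : open U -> Cinf U F -> Cinf U F^`(n).
Proof. by move=> oU; elim: n F => //= n IH F /IH; exact: Cinf_derive1. Qed.

Lemma CinfW U F : (exists2 G, (forall x, U x -> is_derive x 1 F (G x)) & Cinf U G) ->
  Cinf U F.
Proof. by case=> G dG cG [//|n] /=; exists G. Qed.

Lemma Cn_cst n U c : Cn n U (cst c).
Proof.
elim: n c => //= n IH c; exists (cst 0) => // x _; exact: is_derive_cst.
Qed.

Lemma Cn_id n U : Cn n U id.
Proof.
case: n => //= n; exists (cst 1); [move=> x _; exact: is_derive_id|exact: Cn_cst].
Qed.

Lemma CnD n U F G : Cn n U F -> Cn n U G -> Cn n U (F \+ G).
Proof.
elim: n F G => //= n IH F G [F' dF cF] [G' dG cG].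
exists (F' \+ G'); last exact: IH.
by move=> x Ux; have := dF x Ux; have := dG x Ux => ? ?; exact: is_deriveD.
Qed.

Lemma CnM n U F G : Cn n U F -> Cn n U G -> Cn n U (F \* G).
Proof.
elim: n F G => // n IH F G [F' dF cF] [G' dG cG].
exists ((F \* G') \+ (G \* F')).
  move=> x Ux; have := dF x Ux; have := dG x Ux => ? ?.
  exact: is_deriveM.
apply: CnD; apply: IH => //; apply: Cn_le => /=; by [exists F'|exists G'].
Qed.

Lemma CnN n U F : Cn n U F -> Cn n U (\- F).
Proof.
elim: n F => //= n IH F [F' dF cF].
exists (\- F'); last exact: IH.
by move=> x Ux; have := dF x Ux => ?; exact: is_deriveN.
Qed.

Lemma Cn_comp n U V F G : (forall x, U x -> V (G x)) ->
  Cn n V F -> Cn n U G -> Cn n U (F \o G).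
Proof.
move=> UV; elim: n F G UV => // n IH F G UV [F' dF cF] [G' dG cG].
exists ((F' \o G) \* G').
  move=> x Ux; have := dF _ (UV x Ux); have := dG x Ux => ? ?.
  exact: is_derive1_comp.
apply: CnM => //; apply: IH => //; apply: Cn_le => /=; by exists G'.
Qed.

(** Bootstrapping: each derivative of a solution of the equation F' = v(F) is
    expressed by lower ones, so F inherits all the smoothness of v. *)
Lemma Cinf_autonomous U V F v : (forall x, U x -> V (F x)) -> Cinf V v ->
  (forall x, U x -> is_derive x 1 F (v (F x))) -> Cinf U F.
Proof.
move=> UV cv dF; elim=> // n IH; exists (v \o F) => //.
exact: Cn_comp UV (cv n) IH.
Qed.

Lemma Cinf_inv U F : (forall x, U x -> F x != 0) -> Cinf U F ->
  Cinf U (fun x => (F x)^-1).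
Proof.
move=> F0 cF n; apply: (@Cn_comp n U [set y | y != 0] (fun y => y^-1)) => //.
apply: (@Cinf_autonomous _ [set y | y != 0] _ (\- (id \* id))).
- by move=> x /= x0; rewrite invr_neq0.
- by move=> m; apply/CnN/CnM; exact: Cn_id.
- move=> x /= x0; have := is_deriveV x0 (is_derive_id x (1 : R)).
  by rewrite /GRing.scale /= mulr1 expr2 invfM.
Qed.

Lemma Cinf_sqrt U F : (forall x, U x -> 0 < F x) -> Cinf U F ->
  Cinf U (fun x => Num.sqrt (F x)).
Proof.
move=> F0 cF n; apply: (@Cn_comp n U [set y | 0 < y] Num.sqrt) => //.
apply: (@Cinf_autonomous _ [set y : R | 0 < y] _ (fun y => (2 * y)^-1)).
- by move=> x /= x0; rewrite sqrtr_gt0.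
- apply: Cinf_inv; first by move=> x /= x0; rewrite mulf_neq0 ?gt_eqF.
  by move=> m; apply: CnM; [exact: Cn_cst|exact: Cn_id].
Qed.

Lemma Cinf_cst U c : Cinf U (cst c).
Proof. by move=> n; exact: Cn_cst. Qed.

Lemma Cinf_id U : Cinf U id.
Proof. by move=> n; exact: Cn_id. Qed.

Lemma CinfD U F G : Cinf U F -> Cinf U G -> Cinf U (fun x => F x + G x).
Proof. by move=> cF cG n; exact: CnD. Qed.

Lemma CinfN U F : Cinf U F -> Cinf U (fun x => - F x).
Proof. by move=> cF n; exact: CnN. Qed.

Lemma CinfB U F G : Cinf U F -> Cinf U G -> Cinf U (fun x => F x - G x).
Proof. by move=> cF cG; apply: CinfD => //; exact: CinfN. Qed.

Lemma CinfM U F G : Cinf U F -> Cinf U G -> Cinf U (fun x => F x * G x).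
Proof. by move=> cF cG n; exact: CnM. Qed.

Lemma Cinf_comp U V F G : (forall x, U x -> V (G x)) ->
  Cinf V F -> Cinf U G -> Cinf U (fun x => F (G x)).
Proof. by move=> UV cF cG n; exact: Cn_comp UV (cF n) (cG n). Qed.

Lemma is_derive_ext F (x d d' : R) : is_derive x 1 F d -> d = d' ->
  is_derive x 1 F d'.
Proof. by move=> dF <-. Qed.

Lemma is_derD F G (x a b : R) : is_derive x 1 F a -> is_derive x 1 G b ->
  is_derive x 1 (fun y => F y + G y) (a + b).
Proof. by move=> dF dG; exact: is_deriveD. Qed.

Lemma is_derB F G (x a b : R) : is_derive x 1 F a -> is_derive x 1 G b ->
  is_derive x 1 (fun y => F y - G y) (a - b).
Proof. by move=> dF dG; exact: is_deriveB. Qed.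

Lemma is_derM F G (x a b : R) : is_derive x 1 F a -> is_derive x 1 G b ->
  is_derive x 1 (fun y => F y * G y) (a * G x + F x * b).
Proof.
move=> dF dG; have dFG := @is_deriveM R R^o F G x 1 a b dF dG.
by apply: (is_derive_ext dFG); rewrite addrC /GRing.scale /= [G x * a]mulrC.
Qed.

Lemma is_derZ c F (x a : R) : is_derive x 1 F a ->
  is_derive x 1 (fun y => c * F y) (c * a).
Proof. by move=> dF; exact: (is_deriveZ c dF). Qed.

Lemma is_derV F (x a : R) : F x != 0 -> is_derive x 1 F a ->
  is_derive x 1 (fun y => (F y)^-1) (- a / F x ^+ 2).
Proof.
move=> F0 dF; have dV := is_deriveV F0 dF.
by apply: (is_derive_ext dV); rewrite /GRing.scale /= !mulNr mulrC.
Qed.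

Lemma is_derX k (x : R) :
  is_derive x 1 (fun y : R => y ^+ k.+1) (k.+1%:R * x ^+ k).
Proof.
have -> : (fun y : R => y ^+ k.+1) = (id : R -> R) ^+ k.+1.
  by apply/funext => y; rewrite exprfctE.
by apply: is_derive_ext; rewrite /GRing.scale /= mulr1.
Qed.

Lemma is_der_comp F G (x a b : R) : is_derive (G x) 1 F a ->
  is_derive x 1 G b -> is_derive x 1 (fun y => F (G y)) (a * b).
Proof. by move=> dF dG; exact: is_derive1_comp. Qed.

End SmoothFunctions.


(** * Frechet smoothness in terms of ordinary derivatives *)

Section SmoothOn.
Context {R : realType}.

Lemma near_eq_differentiable (V W : normedModType R) (F G : V -> W) x :
  (\near x, F x = G x) -> differentiable F x -> differentiable G x.
Proof.
move=> FG /diff_locallyP [cF eF].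
have eG : G \o shift x = cst (G x) + 'd F x +o_ 0 id.
  apply/eqaddoP => e e0; move/eqaddoP/(_ e e0): eF => eF.
  have FG0 : \forall h \near 0, F (h + x) = G (h + x).
    by have := FG; rewrite (near_shift 0) subr0.
  near=> h; have -> : (G \o shift x - (cst (G x) + 'd F x)) h =
      (F \o shift x - (cst (F x) + 'd F x)) h.
    by rewrite !fctE /=; congr (_ - (_ + _)); [symmetry; near: h|
       symmetry; exact: nbhs_singleton FG].
  by near: h.
have dG : 'd G x = 'd F x :> (V -> W) by exact: diff_unique.
by apply/diff_locallyP; rewrite dG.
Unshelve. all: by end_near. Qed.

Lemma derive_linear (V W W' : normedModType R) (A : {linear W -> W'})
    (F : V -> W) (x v : V) : continuous A -> differentiable F x ->
  'D_v (A \o F) x = A ('D_v F x).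
Proof.
move=> cA dF; have dA y : differentiable A y by exact: linear_differentiable.
rewrite !deriveE//; last exact: differentiable_comp.
by rewrite diff_comp// diff_lin.
Qed.

Lemma iterD_linear (V W W' : normedModType R) (A : {linear W -> W'})
    (U : set V) (F : V -> W) (vs : seq V) x : continuous A -> open U ->
  smooth_on U F -> U x -> Defs.iterD vs (A \o F) x = A (Defs.iterD vs F x).
Proof.
move=> cA oU sF; elim: vs x => //= v vs IH x Ux.
rewrite -(derive_linear _ cA (sF vs x Ux)); apply: near_eq_derive.
by apply: filterS (open_nbhs_nbhs (conj oU Ux)) => y; exact: IH.
Qed.

Lemma smooth_on_linear (V W W' : normedModType R) (A : {linear W -> W'})
    (U : set V) (F : V -> W) : continuous A -> open U ->
  smooth_on U F -> smooth_on U (A \o F).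
Proof.
move=> cA oU sF vs x Ux.
apply: (@near_eq_differentiable _ _ (A \o Defs.iterD vs F)).
  apply: filterS (open_nbhs_nbhs (conj oU Ux)) => y Uy.
  by rewrite (iterD_linear _ cA oU sF Uy).
by apply: differentiable_comp; [exact: sF|exact: linear_differentiable].
Qed.

Lemma iterD_pair (V W W' : normedModType R) (U : set V) (F : V -> W)
    (G : V -> W') (vs : seq V) x : open U -> smooth_on U F -> smooth_on U G ->
  U x -> Defs.iterD vs (fun y => (F y, G y)) x = (Defs.iterD vs F x, Defs.iterD vs G x).
Proof.
move=> oU sF sG; elim: vs x => //= v vs IH x Ux.
rewrite (@near_eq_derive _ _ _ _ (fun y => (Defs.iterD vs F y, Defs.iterD vs G y))).
  have dF := sF vs x Ux; have dG := sG vs x Ux.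
  by rewrite !deriveE// ?diff_pair//; exact: differentiable_pair.
by apply: filterS (open_nbhs_nbhs (conj oU Ux)) => y; exact: IH.
Qed.

Lemma smooth_on_pair (V W W' : normedModType R) (U : set V) (F : V -> W)
    (G : V -> W') : open U -> smooth_on U F -> smooth_on U G ->
  smooth_on U (fun y => (F y, G y)).
Proof.
move=> oU sF sG vs x Ux.
apply: (@near_eq_differentiable _ _ (fun y => (Defs.iterD vs F y, Defs.iterD vs G y))).
  apply: filterS (open_nbhs_nbhs (conj oU Ux)) => y Uy.
  by rewrite (iterD_pair _ oU sF sG Uy).
by apply: differentiable_pair; [exact: sF|exact: sG].
Qed.

Lemma derive_compN (V W : normedModType R) (F : V -> W) (x v : V) :
  'D_v (F \o -%R) x = 'D_(- v) F (- x).
Proof.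
rewrite /derive; suff -> : (fun h => h^-1 *:
    (((F \o -%R) \o shift x) (h *: v) - (F \o -%R) x)) =
    (fun h => h^-1 *: ((F \o shift (- x)) (h *: - v) - F (- x))) by [].
by apply/funext => h /=; rewrite opprD scalerN.
Qed.

Lemma iterD_compN (V W : normedModType R) (F : V -> W) (vs : seq V) :
  Defs.iterD vs (F \o -%R) = Defs.iterD (map -%R vs) F \o -%R.
Proof.
elim: vs => //= v vs ->; apply/funext => x /=; exact: derive_compN.
Qed.

Lemma smooth_on_compN (V W : normedModType R) (U : set V) (F : V -> W) :
  smooth_on U F -> smooth_on [set x | U (- x)] (F \o -%R).
Proof.
move=> sF vs x /= Ux; rewrite iterD_compN; apply: differentiable_comp => //.
exact: sF.
Qed.

(** On the line an iterated directional derivative is a constant multiple of an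
    ordinary iterated derivative. *)
Lemma Cinf_smooth_on (U : set R) (F : R -> R) :
  open U -> smooth_on U F <-> Cinf U F.
Proof.
move=> oU; split=> [sF n|cF vs x Ux].
  suff: forall k, Cn n U (Defs.iterD (nseq k (1 : R)) F) by move/(_ 0%N).
  elim: n => //= n IH k; exists (Defs.iterD (nseq k.+1 (1 : R)) F) => // x Ux.
  apply: derivableP; apply/derivable1_diffP; exact: sF.
have [H cH eH] : exists2 H, Cinf U H & forall y, U y -> Defs.iterD vs F y = H y.
  elim: vs => [|v vs [H cH eH]]; first by exists F.
  exists (fun y => v * derive1 H y).
    by apply: CinfM; [exact: Cinf_cst|exact: Cinf_derive1].
  move=> y Uy /=; rewrite (@near_eq_derive _ _ _ _ H).
    have dH : differentiable H y.
      by apply/derivable1_diffP; exact: Cinf_derivable cH Uy.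
    by rewrite deriveE// diff1E.
  by apply: filterS (open_nbhs_nbhs (conj oU Uy)) => z; exact: eH.
apply: (@near_eq_differentiable _ _ H).
  by apply: filterS (open_nbhs_nbhs (conj oU Ux)) => y Uy; rewrite eH.
by apply/derivable1_diffP; exact: Cinf_derivable cH Ux.
Qed.

Lemma continuous_fst (V W : normedModType R) :
  continuous (fst : (V * W)%type -> V).
Proof. by move=> x; exact: cvg_fst. Qed.

Lemma continuous_snd (V W : normedModType R) :
  continuous (snd : (V * W)%type -> W).
Proof. by move=> x; exact: cvg_snd. Qed.

Lemma smooth_on_plane (U : set R) (g : R -> R * R) : open U ->
  smooth_on U g <-> Cinf U (fst \o g) /\ Cinf U (snd \o g).
Proof.
move=> oU; split=> [sg|[/Cinf_smooth_on c1 /Cinf_smooth_on c2]].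
  by split; apply/Cinf_smooth_on => //; apply: smooth_on_linear => //;
    [exact: continuous_fst|exact: continuous_snd].
have -> : g = fun t => ((fst \o g) t, (snd \o g) t).
  by apply/funext => t /=; case: (g t).
by apply: smooth_on_pair; [|exact: c1|exact: c2].
Qed.

Lemma derive1_plane (g : R -> R * R) t : derivable (fst \o g) t 1 ->
  derivable (snd \o g) t 1 ->
  g^`() t = ((fst \o g)^`() t, (snd \o g)^`() t).
Proof.
move=> /derivable1_diffP d1 /derivable1_diffP d2.
have eg : g = fun t => ((fst \o g) t, (snd \o g) t).
  by apply/funext => s /=; case: (g s).
rewrite {1}eg !derive1E !deriveE// ?diff_pair//; exact: differentiable_pair.
Qed.

End SmoothOn.

(** * The inverse function theorem on the line *)

Section InverseFunction.
Context {R : realType}.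
Implicit Types (U V : set R) (F G h g : R -> R).

Definition oball (a d : R) : set R := [set x | a - d < x < a + d].

Lemma oballP a d x : oball a d x <-> `|x - a| < d.
Proof.
by rewrite /oball /= ltr_norml; split=> /andP[? ?]; apply/andP; split; lra.
Qed.

Lemma oball_center a d : 0 < d -> oball a d a.
Proof. by move=> d0; apply/oballP; rewrite subrr normr0. Qed.

Lemma open_oball a d : open (oball a d).
Proof.
have -> : oball a d = `]a - d, a + d[%classic by rewrite predeqE.
exact: itv_open.
Qed.

Lemma nbhs_oball a (P : set R) : nbhs a P ->
  exists2 d, 0 < d & oball a d `<=` P.
Proof.
move=> /nbhs_ballP [d /= d0 dP]; exists d => // x /oballP xa; apply: dP.
by rewrite /ball /= distrC.
Qed.

Lemma oball_nbhs a d : 0 < d -> nbhs a (oball a d).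
Proof.
by move=> d0; apply: open_nbhs_nbhs; split; [exact: open_oball|exact: oball_center].
Qed.

Lemma oball_sub a d x y z : oball a d x -> oball a d y -> x <= z <= y ->
  oball a d z.
Proof.
move=> /andP[x1 x2] /andP[y1 y2] /andP[xz zy]; apply/andP; split.
  exact: lt_le_trans x1 xz.
exact: le_lt_trans zy y2.
Qed.

Lemma derive_pos_incr F (a b : R) : (forall x, a <= x <= b -> derivable F x 1) ->
  (forall x, a <= x <= b -> 0 < derive1 F x) -> a < b -> F a < F b.
Proof.
move=> dF pF ab.
have [] := @MVT R F (derive1 F) a b ab.
- move=> x; rewrite in_itv /= => /andP[ax xb]; rewrite derive1E.
  by apply: derivableP; apply: dF; rewrite !ltW.
- apply: continuous_in_subspaceT => x; rewrite inE /= in_itv /= => xab.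
  by apply: differentiable_continuous; apply/derivable1_diffP; exact: dF.
move=> c; rewrite in_itv /= => /andP[ac cb] E; rewrite -subr_gt0 E.
by rewrite mulr_gt0 ?subr_gt0// pF// !ltW.
Qed.

(** Both open sets are given: V carries the new parameter, and W tells which
    points are reached, as needed to describe a whole neighbourhood of a point
    in Sigma.  Smoothness of g comes from its equation g' = 1 / h'(g). *)
Lemma inverse_function U h a : open U -> U a -> Cinf U h -> 0 < derive1 h a ->
  exists g e W, [/\ 0 < e, open W, W a, W `<=` U &
    let V := oball (h a) e in
    [/\ Cinf V g, forall x, W x -> V (h x) /\ g (h x) = x,
        forall y, V y -> W (g y) /\ h (g y) = y,
        forall x, W x -> 0 < derive1 h x &
        forall y, V y -> is_derive y 1 g (derive1 h (g y))^-1]].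
Proof.
move=> oU Ua ch h'a.
have ch' := Cinf_derive1 oU ch.
have [r r0 rU] : exists2 r, 0 < r & oball a r `<=` [set x | U x /\ 0 < derive1 h x].
  apply: nbhs_oball; apply: filterI; first exact: open_nbhs_nbhs.
  have := Cinf_continuous ch' Ua; move=> /(_ _)/= c.
  exact: (cvgr_gt (derive1 h a) c _ h'a).
have [d d0 dr] : exists2 d, 0 < d & d < r by exists (r / 2); lra.
pose lo := a - d; pose hi := a + d.
have inU x : lo <= x <= hi -> U x /\ 0 < derive1 h x.
  by rewrite /lo /hi => /andP[? ?]; apply: rU; apply/andP; split; lra.
have incr x y : lo <= x -> y <= hi -> x < y -> h x < h y.
  move=> lx yh xy; apply: derive_pos_incr => // z /andP[xz zy].
    apply: Cinf_derivable ch _; apply: (inU _ _).1.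
    by rewrite (le_trans lx xz) (le_trans zy yh).
  by apply: (inU _ _).2; rewrite (le_trans lx xz) (le_trans zy yh).
have inj x y : lo <= x <= hi -> lo <= y <= hi -> h x = h y -> x = y.
  move=> /andP[x1 x2] /andP[y1 y2] E.
  by case: (ltgtP x y) => // xy;
    [have := incr x y x1 y2 xy|have := incr y x y1 x2 xy]; rewrite E ltxx.
have lha : h lo < h a by apply: incr; rewrite /lo /hi; lra.
have hah : h a < h hi by apply: incr; rewrite /lo /hi; lra.
pose e := Num.min (h a - h lo) (h hi - h a).
have e0 : 0 < e by rewrite /e lt_min !subr_gt0 lha.
have e1 : e <= h a - h lo by rewrite /e ge_min lexx.
have e2 : e <= h hi - h a by rewrite /e ge_min lexx orbT.
pose V := oball (h a) e.
pose W := [set x | lo < x < hi /\ V (h x)].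
pose g y := xget a [set x | lo < x < hi /\ h x = y].
have gP y : V y -> lo < g y < hi /\ h (g y) = y.
  move=> /andP[Vy1 Vy2].
  apply: (@xgetPex _ a [set x | lo < x < hi /\ h x = y]).
  have [] := @IVT R h lo hi y; first by rewrite /lo /hi; lra.
  - apply: continuous_in_subspaceT => x; rewrite inE /= in_itv /= => xab.
    exact: Cinf_continuous ch (inU x xab).1.
  - by rewrite ge_min le_max; apply/andP; split; apply/orP; [left|right]; lra.
  move=> x; rewrite in_itv /= => /andP[x1 x2] hx; exists x; split => //.
  rewrite !lt_neqAle x1 x2 !andbT; apply/andP; split; apply/eqP => E.
    by move: hx; rewrite -E; lra.
  by move: hx; rewrite E; lra.
have gK x : W x -> g (h x) = x.
  move=> [/andP[x1 x2] Vhx]; have [/andP[? ?] E] := gP _ Vhx.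
  by apply: inj => //; rewrite !ltW.
have WU : W `<=` U by move=> x [/andP[x1 x2] _]; apply: (inU _ _).1; rewrite !ltW.
have Wpos x : W x -> 0 < derive1 h x.
  by move=> [/andP[x1 x2] _]; apply: (inU _ _).2; rewrite !ltW.
have gW y : V y -> W (g y) by move=> Vy; have [? E] := gP _ Vy; split; rewrite ?E.
have oW : open W.
  rewrite openE => x [xI Vhx]; apply: filterI.
    by apply: open_nbhs_nbhs; split => //; apply: itv_open => //=; rewrite in_itv.
  have hx : {for x, continuous h}.
    by apply: Cinf_continuous ch _; apply: WU.
  by apply: hx; apply: open_nbhs_nbhs; split => //; exact: open_oball.
have dg y : V y -> is_derive y 1 g (derive1 h (g y))^-1.
  move=> Vy; have [_ E] := gP _ Vy; have Wy := gW _ Vy.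
  rewrite -{1}E; apply: is_derive_inverse.
  - by apply: filterS (open_nbhs_nbhs (conj oW Wy)) => x; exact: gK.
  - apply: filterS (open_nbhs_nbhs (conj oW Wy)) => x Wx.
    by apply: Cinf_continuous ch _; exact: WU.
  - by apply: Cinf_is_derive ch _; exact: WU.
  - by rewrite gt_eqF// Wpos.
exists g, e, W; split => //.
  by split; [rewrite /lo /hi; lra|apply: oball_center].
split=> //.
- apply: (@Cinf_autonomous _ _ W _ (fun x => (derive1 h x)^-1)) => //.
  apply: Cinf_inv; first by move=> x /Wpos /gt_eqF ->.
  exact: Cinf_sub WU ch'.
- by move=> x Wx; split; [case: Wx|exact: gK].
- by move=> y Vy; split; [exact: gW|case: (gP _ Vy)].
Qed.

End InverseFunction.

(** * Hadamard's lemma *)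

Section Hadamard.
Context {R : realType}.
Implicit Types (U V : set R) (F G h g : R -> R).

Lemma MVT_oball F dF (a d b : R) : (forall x, oball a d x -> is_derive x 1 F (dF x)) ->
  oball a d b -> exists c, [/\ `|c - a| <= `|b - a|, oball a d c &
    F b - F a = dF c * (b - a)].
Proof.
move=> dd Bb; have d0 : 0 < d by move/oballP: Bb; exact: le_lt_trans.
have Ba := oball_center a d0.
have cont x y : oball a d x -> oball a d y -> {within `[x, y], continuous F}.
  move=> Bx By; apply: continuous_in_subspaceT => z; rewrite inE /= in_itv /= => zxy.
  apply: differentiable_continuous; apply/derivable1_diffP.
  by have [] := dd z (oball_sub Bx By zxy).
case: (ltgtP a b) => [ab|ba|<-]; last first.
- by exists a; split => //; rewrite !subrr mulr0.
- have [|c] := @MVT R F dF b a ba _ (cont _ _ Bb Ba).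
    move=> x; rewrite in_itv /= => /andP[/ltW bx /ltW xa].
    by apply: dd; apply: oball_sub Bb Ba _; rewrite bx.
  rewrite in_itv /= => /andP[bc ca] E; exists c; split.
  + by rewrite !ltr0_norm ?subr_lt0//; lra.
  + by apply: oball_sub Bb Ba _; rewrite !ltW.
  + by rewrite -opprB E -mulrN opprB.
- have [|c] := @MVT R F dF a b ab _ (cont _ _ Ba Bb).
    move=> x; rewrite in_itv /= => /andP[/ltW bx /ltW xa].
    by apply: dd; apply: oball_sub Ba Bb _; rewrite bx.
  rewrite in_itv /= => /andP[bc ca] E; exists c; split => //.
  + by rewrite !gtr0_norm ?subr_gt0//; lra.
  + by apply: oball_sub Ba Bb _; rewrite !ltW.
Qed.

(** P_k(x) / x^(k+1) is the average of u |-> u^k F^(k+1)(u x) over [0, 1];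
    differentiating under that integral turns k into k.+1. *)
Fixpoint hadamard_num F k : R -> R :=
  if k is j.+1 then
    fun x => x ^+ j.+1 * derive1n j.+1 F x - j.+1%:R * hadamard_num F j x
  else F.

Definition hadamard_quot F k : R -> R := fun x =>
  if x == 0 then derive1n k.+1 F 0 / k.+1%:R else hadamard_num F k x / x ^+ k.+1.

Lemma is_derive_hadamard_num U F k (x : R) : open U -> Cinf U F -> U x ->
  is_derive x 1 (hadamard_num F k) (x ^+ k * derive1n k.+1 F x).
Proof.
move=> oU cF Ux; elim: k => [|k IH].
  by rewrite expr0 mul1r; exact: Cinf_is_derive cF Ux.
have dF := Cinf_is_derive (Cinf_derive1n k.+1 oU cF) Ux.
rewrite -derive1nS in dF.
have dX := is_derX k x.
apply: (is_derive_ext (is_derB (is_derM dX dF) (is_derZ k.+1%:R IH))).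
by rewrite /=; ring.
Qed.

Lemma hadamard_num0 F k : F 0 = 0 -> hadamard_num F k 0 = 0.
Proof. by move=> F0; elim: k => //= k ->; rewrite expr0n mul0r mulr0 subrr. Qed.

Lemma is_derive_hadamard_quot U F k (x : R) : open U -> U 0 -> Cinf U F -> F 0 = 0 ->
  U x -> is_derive x 1 (hadamard_quot F k) (hadamard_quot F k.+1 x).
Proof.
move=> oU U0 cF F0 Ux; have [x0|x0] := eqVneq x 0.
  move: Ux; rewrite {}x0 => _; rewrite /hadamard_quot eqxx.
  set c := derive1n k.+1 F 0; set c' := derive1n k.+2 F 0.
  have dG := Cinf_is_derive (Cinf_derive1n k.+1 oU cF) U0.
  rewrite -derive1nS -/c' in dG.
  have /is_derive1_caratheodory [S [SE cS S0]] := dG.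
  apply/is_derive1_caratheodory.
  pose q := hadamard_quot F k.
  exists (fun z => if z == 0 then c' / k.+2%:R else (q z - c / k.+1%:R) / z).
  split; last by rewrite eqxx.
    move=> z; rewrite eqxx; case: ifPn => [/eqP ->|z0].
      by rewrite !subrr mulr0.
    by rewrite subr0 divfK// /q /hadamard_quot (negbTE z0).
  rewrite /prop_for /continuous_at eqxx; apply/cvgrPdist_le => e e0.
  have [d d0 dU] : exists2 d, 0 < d &
      oball 0 d `<=` [set x | U x /\ `|S 0 - S x| <= e].
    apply: nbhs_oball; apply: filterI; first exact: open_nbhs_nbhs.
    by move/cvgrPdist_le: cS; apply.
  apply: filterS (oball_nbhs 0 d0) => z Bz; case: ifPn => [_|z0].
    by rewrite subrr normr0 ltW.
  (* M is the remainder of an expansion of order k+2 of the numerator: its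
     derivative is y^(k+1) (S y - S 0), whence M z = o(z^(k+2)). *)
  pose M := fun y => hadamard_num F k y - (c / k.+1%:R * y ^+ k.+1 +
                       c' / k.+2%:R * y ^+ k.+2).
  have dX := @is_derX R.
  have dM y : oball 0 d y -> is_derive y 1 M (y ^+ k.+1 * (S y - S 0)).
    move=> By; have [Uy _] := dU _ By.
    have dP := is_derive_hadamard_num k oU cF Uy.
    have dM := is_derB dP (is_derD
      (is_derZ (c / k.+1%:R) (dX k y)) (is_derZ (c' / k.+2%:R) (dX k.+1 y))).
    apply: (is_derive_ext dM).
    have -> : derive1n k.+1 F y = c + S y * y 
      by have := SE y; rewrite subr0 -/c => <-; rewrite addrC subrK.
    by rewrite S0 /= exprS !mulrA !divfK ?pnatr_eq0//; ring.
  have [y [yz By E]] := MVT_oball dM Bz.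
  have M0 : M 0 = 0 by rewrite /M hadamard_num0// !expr0n !mulr0 addr0 subrr.
  rewrite M0 !subr0 in E yz.
  have -> : c' / k.+2%:R - (q z - c / k.+1%:R) / z = - (M z / z ^+ k.+2).
    rewrite /M /q /hadamard_quot (negbTE z0) !exprS.
    have := @expf_neq0 R z k z0; move: (z ^+ k) => w w0.
    have := pnatr_eq0 R k.+1; have := pnatr_eq0 R k.+2.
    move: (k.+1%:R : R) (k.+2%:R : R) => k1 k2 /= /negbT k20 /negbT k10.
    by field; rewrite k10 k20 w0 z0.
  rewrite normrN E normf_div normrM normrM normrX normrX.
  rewrite ler_pdivrMr ?exprn_gt0 ?normr_gt0// (exprSr (`|z|)) mulrA ler_wpM2r//.
  rewrite mulrC; apply: ler_pM => //; last by rewrite lerXn2r ?nnegrE.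
  by rewrite distrC; case: (dU _ By).
have oU' : open (U `&` [set y | y != 0]) by apply: openI => //; exact: open_neq.
apply: (@is_derive_eq_on _ _ (fun y => hadamard_num F k y * (y ^+ k.+1)^-1)
   _ _ _ oU') => //.
  by move=> y [_ /= /negbTE y0]; rewrite /hadamard_quot y0.
have dP := is_derive_hadamard_num k oU cF Ux.
have dX := is_derX k x.
have dV := @is_derV R (fun y => y ^+ k.+1) x _ (expf_neq0 k.+1 x0) dX.
apply: (is_derive_ext (is_derM dP dV)).
rewrite /hadamard_quot (negbTE x0) /= !exprS.
have := @expf_neq0 R x k x0; move: (x ^+ k) => w w0.
by field; rewrite x0 w0.
Qed.

(** Each average in the sequence hadamard_quot F k is the derivative of the
    preceding one, so all of them are smooth. *)
Lemma hadamard U F : open U -> U 0 -> Cinf U F -> F 0 = 0 ->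
  exists q, [/\ Cinf U q, q 0 = derive1 F 0 & forall x, U x -> F x = x * q x].
Proof.
move=> oU U0 cF F0; exists (hadamard_quot F 0); split.
- suff cq n : forall k, Cn n U (hadamard_quot F k) by move=> n; exact: cq.
  elim: n => //= n IH k; exists (hadamard_quot F k.+1) => // x Ux.
  exact: is_derive_hadamard_quot Ux.
- by rewrite /hadamard_quot eqxx divr1 derive1n1.
- move=> x Ux; rewrite /hadamard_quot; case: eqP => [->|/eqP x0].
    by rewrite F0 mul0r.
  by rewrite /= expr1 mulrC divfK.
Qed.

End Hadamard.

(** * Parameterization by arc length *)

Section UnitSpeed.
Context {R : realType}.
Implicit Types (U V : set R) (F G h g v : R -> R).

Lemma local_primitive G (a b : R) : continuous G ->
  exists P, forall x, a < x < b -> is_derive x 1 P (G x).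
Proof.
move=> cG; exists (fun x => (\int[lebesgue_measure]_(t in `[a, x]) G t)%R).
move=> x /andP[ax xb].
have iG : (@lebesgue_measure R).-integrable `[a, b] (EFin \o G).
  apply: continuous_compact_integrable; first exact: segment_compact.
  exact: continuous_subspaceT.
have [dP EP] := continuous_FTC1_closed xb iG ax (cG x).
by rewrite derive1E in EP; exact: DeriveDef dP EP.
Qed.

(** The inverse phi of the arc length solves phi' = 1 / v(phi), and so is as
    smooth as v; the sign sg chooses the orientation. *)
Lemma unit_speed_change v (s sg : R) : Cinf setT v -> (forall x, 0 < v x) ->
  sg = 1 \/ sg = -1 ->
  exists phi e, [/\ 0 < e, phi 0 = s, Cinf (oball 0 e) phi &
    forall x, oball 0 e x -> is_derive x 1 phi (sg / v (phi x))].
Proof.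
move=> cv v0 sgE.
have [|L0 dL0] := @local_primitive v (s - 1) (s + 1).
  by move=> x; exact: Cinf_continuous cv _.
pose L x := L0 x - L0 s.
have dL x : oball s 1 x -> is_derive x 1 L (v x).
  by move=> Bx; apply: (is_derive_ext (is_derB (dL0 _ Bx) (is_derive_cst _ _ _)));
    rewrite subr0.
have s1 : oball s 1 s by exact: oball_center.
have cL : Cinf (oball s 1) L.
  by apply: CinfW; exists v => //; apply: Cinf_sub cv.
have Ls : derive1 L s = v s by have [_ <-] := dL s s1; rewrite derive1E.
have L0s : L s = 0 by rewrite /L subrr.
have [|g [e [W [e0 oW Ws WU [cg hK gK hpos dg]]]]] :=
  inverse_function (@open_oball R s 1) s1 cL; first by rewrite Ls.
rewrite L0s in cg hK gK dg.
have dg' y : oball 0 e y -> is_derive y 1 g (v (g y))^-1.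
  move=> By; apply: (is_derive_ext (dg y By)); congr (_^-1).
  have [Wg _] := gK _ By; have [_ <-] := dL _ (WU _ Wg); by rewrite derive1E.
have Bs y : oball 0 e y -> oball 0 e (sg * y).
  move=> /oballP; rewrite subr0 => By; apply/oballP; rewrite subr0 normrM.
  by case: sgE => ->; rewrite ?normrN normr1 mul1r.
exists (fun x => g (sg * x)), e; split => //.
- rewrite mulr0; have [_ gs] := hK _ Ws; by rewrite L0s in gs.
- apply: (@Cinf_comp _ _ (oball 0 e)) => //.
  by apply: CinfM; [exact: Cinf_cst|exact: Cinf_id].
- move=> x Bx; have ds := is_derZ sg (is_derive_id x 1).
  by apply: (is_derive_ext (is_der_comp (dg' _ (Bs _ Bx)) ds)); rewrite mulr1 mulrC.
Qed.

End UnitSpeed.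

(** * Plane curves and periodic functions *)

Section PlaneCurveCalculus.
Context {R : realType}.
Implicit Types (U : set R) (g : R -> R * R).

Lemma derive1_val (F : R -> R) (x d : R) : is_derive x 1 F d -> derive1 F x = d.
Proof. by move=> [_ <-]; rewrite derive1E. Qed.

Lemma is_der_continuous (F : R -> R) (x d : R) : is_derive x 1 F d -> {for x, continuous F}.
Proof.
by move=> [dF _]; apply: differentiable_continuous; apply/derivable1_diffP.
Qed.

Lemma derive1_eq_on (W : normedModType R) (U : set R) (F G : R -> W) x : open U ->
  U x -> (forall y, U y -> F y = G y) -> F^`() x = G^`() x.
Proof.
move=> oU Ux FG; rewrite !derive1E; apply: near_eq_derive.
by apply: filterS (open_nbhs_nbhs (conj oU Ux)) => y; exact: FG.
Qed.

Lemma derive1n_plane U g n x : open U -> Cinf U (fst \o g) -> Cinf U (snd \o g) ->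
  U x -> g^`(n) x = ((fst \o g)^`(n) x, (snd \o g)^`(n) x).
Proof.
move=> oU c1 c2; elim: n x => [|n IH] x Ux; first by rewrite /=; case: (g x).
rewrite !derive1nS (derive1_eq_on oU Ux IH).
have d1 := Cinf_derivable (Cinf_derive1n n oU c1) Ux.
have d2 := Cinf_derivable (Cinf_derive1n n oU c2) Ux.
by rewrite derive1_plane.
Qed.

Lemma derive1_pair U g x : open U -> Cinf U (fst \o g) -> Cinf U (snd \o g) ->
  U x -> g^`() x = (derive1 (fst \o g) x, derive1 (snd \o g) x).
Proof. by move=> oU c1 c2 Ux; exact: (@derive1n_plane U g 1). Qed.

Lemma curvature_plane U g x (a b c d : R) : open U -> Cinf U (fst \o g) ->
  Cinf U (snd \o g) -> U x -> g^`() x = (a, b) -> g^`(2) x = (c, d) ->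
  curvature g x = (a * d - b * c) / Num.sqrt (a ^+ 2 + b ^+ 2) ^+ 3.
Proof. by move=> oU c1 c2 Ux E1 E2; rewrite /curvature E1 E2. Qed.

Lemma periodic_int (F : R -> R) (m : int) t : (forall t, F (t + 1) = F t) ->
  F (t + m%:~R) = F t.
Proof.
move=> pF; elim/int_rect: m t => [|n IH|n IH] t; first by rewrite addr0.
  by rewrite intS rmorphD /= [1 + _]addrC addrA pF IH.
rewrite -(pF (t + _)) -[RHS]IH; congr F.
by rewrite intS opprD rmorphD /= rmorphN /=; ring.
Qed.

Lemma periodic_derive1 (F : R -> R) : Cinf setT F ->
  (forall t, F (t + 1) = F t) -> forall t, derive1 F (t + 1) = derive1 F t.
Proof.
move=> cF pF t; have d1 := Cinf_is_derive cF (I : setT (t + 1)).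
have dD := is_derD (is_derive_id t (1 : R)) (is_derive_cst (1 : R) t (1 : R)).
have [_ E] := @is_der_comp R F (fun y => y + 1) t _ _ d1 dD.
have [_ <-] := Cinf_is_derive cF (I : setT t).
rewrite addr0 mulr1 in E; rewrite -E.
by have -> : (fun y => F (y + 1)) = F by apply/funext => y; exact: pF.
Qed.

End PlaneCurveCalculus.

(** * Parallel tangents of a generic curve *)

Section GenericCurve.
Context {R : realType}.
Variable f : R -> R * R.
Hypothesis closed_f : closed_smooth_curve f.

Let X : R -> R := fst \o f.
Let Y : R -> R := snd \o f.
Definition fx1 : R -> R := derive1 X.
Local Notation X1 := fx1.
Definition fy1 : R -> R := derive1 Y.
Local Notation Y1 := fy1.
Definition fx2 : R -> R := derive1 X1.
Local Notation X2 := fx2.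
Definition fy2 : R -> R := derive1 Y1.
Local Notation Y2 := fy2.
Definition fx3 : R -> R := derive1 X2.
Local Notation X3 := fx3.
Definition fy3 : R -> R := derive1 Y2.
Local Notation Y3 := fy3.

(** The signed curvature times the cube of the speed. *)
Definition wronskian t : R := X1 t * Y2 t - Y1 t * X2 t.
Definition wronskian' t : R := X1 t * Y3 t - Y1 t * X3 t.
Definition tangent_cross s t : R := X1 s * Y1 t - Y1 s * X1 t.
Local Notation cross := tangent_cross.
Definition tangent_dot s t : R := X1 s * X1 t + Y1 s * Y1 t.
Local Notation dot := tangent_dot.
Definition tangent_speed t : R := Num.sqrt (dot t t).
Local Notation speed := tangent_speed.
Local Notation K := wronskian.

Lemma smooth_X : Cinf setT X.
Proof. by have [/(smooth_on_plane _ openT)[]] := closed_f. Qed.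

Lemma smooth_Y : Cinf setT Y.
Proof. by have [/(smooth_on_plane _ openT)[]] := closed_f. Qed.

Lemma smooth_X1 : Cinf setT X1. Proof. exact: Cinf_derive1 openT smooth_X. Qed.
Lemma smooth_Y1 : Cinf setT Y1. Proof. exact: Cinf_derive1 openT smooth_Y. Qed.
Lemma smooth_X2 : Cinf setT X2. Proof. exact: Cinf_derive1 openT smooth_X1. Qed.
Lemma smooth_Y2 : Cinf setT Y2. Proof. exact: Cinf_derive1 openT smooth_Y1. Qed.

Lemma velocityE t : f^`() t = (X1 t, Y1 t).
Proof. exact: derive1_pair openT smooth_X smooth_Y _. Qed.

Lemma accelerationE t : f^`(2) t = (X2 t, Y2 t).
Proof. exact: (@derive1n_plane _ _ _ 2 _ openT smooth_X smooth_Y). Qed.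

Lemma third_derivativeE t : f^`(3) t = (X3 t, Y3 t).
Proof. exact: (@derive1n_plane _ _ _ 3 _ openT smooth_X smooth_Y). Qed.

Lemma crossE s t : det2 (f^`() s) (f^`() t) = cross s t.
Proof. by rewrite !velocityE. Qed.

Lemma is_derive_X (t : R) : is_derive t 1 X (X1 t).
Proof. exact: Cinf_is_derive smooth_X I. Qed.
Lemma is_derive_Y (t : R) : is_derive t 1 Y (Y1 t).
Proof. exact: Cinf_is_derive smooth_Y I. Qed.
Lemma is_derive_X1 (t : R) : is_derive t 1 X1 (X2 t).
Proof. exact: Cinf_is_derive smooth_X1 I. Qed.
Lemma is_derive_Y1 (t : R) : is_derive t 1 Y1 (Y2 t).
Proof. exact: Cinf_is_derive smooth_Y1 I. Qed.
Lemma is_derive_X2 (t : R) : is_derive t 1 X2 (X3 t).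
Proof. exact: Cinf_is_derive smooth_X2 I. Qed.
Lemma is_derive_Y2 (t : R) : is_derive t 1 Y2 (Y3 t).
Proof. exact: Cinf_is_derive smooth_Y2 I. Qed.

Lemma smooth_K : Cinf setT K.
Proof.
by apply: CinfB; apply: CinfM; 
  [exact: smooth_X1|exact: smooth_Y2|exact: smooth_Y1|exact: smooth_X2].
Qed.

Lemma X1_int (m : int) t : X1 (t + m%:~R) = X1 t.
Proof.
apply: periodic_int; apply: periodic_derive1; first exact: smooth_X.
by move=> s; rewrite /X /=; have [_ ->] := closed_f.
Qed.

Lemma Y1_int (m : int) t : Y1 (t + m%:~R) = Y1 t.
Proof.
apply: periodic_int; apply: periodic_derive1; first exact: smooth_Y.
by move=> s; rewrite /Y /=; have [_ ->] := closed_f.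
Qed.

Lemma derive1_int (F : R -> R) (m : int) t : Cinf setT F ->
  (forall s, F (s + 1) = F s) -> derive1 F (t + m%:~R) = derive1 F t.
Proof. by move=> cF pF; apply: periodic_int; exact: periodic_derive1. Qed.

Lemma X2_int (m : int) t : X2 (t + m%:~R) = X2 t.
Proof. by apply: derive1_int; [exact: smooth_X1|move=> s; exact: (X1_int 1)]. Qed.

Lemma Y2_int (m : int) t : Y2 (t + m%:~R) = Y2 t.
Proof. by apply: derive1_int; [exact: smooth_Y1|move=> s; exact: (Y1_int 1)]. Qed.

Lemma K_int (m : int) t : K (t + m%:~R) = K t.
Proof. by rewrite /wronskian X1_int Y1_int X2_int Y2_int. Qed.

Lemma K'_int (m : int) t : wronskian' (t + m%:~R) = wronskian' t.
Proof.
have x3 : X3 (t + m%:~R) = X3 t.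
  by apply: derive1_int; [exact: smooth_X2|move=> s; exact: (X2_int 1)].
have y3 : Y3 (t + m%:~R) = Y3 t.
  by apply: derive1_int; [exact: smooth_Y2|move=> s; exact: (Y2_int 1)].
by rewrite /wronskian' X1_int Y1_int x3 y3.
Qed.

(* Unification is not to look inside these functions. *)
Opaque fx1 fy1 fx2 fy2 fx3 fy3.

Lemma is_derive_K (t : R) : is_derive t 1 K (wronskian' t).
Proof.
apply: (is_derive_ext (is_derB (is_derM (is_derive_X1 t) (is_derive_Y2 t))
                               (is_derM (is_derive_Y1 t) (is_derive_X2 t)))).
by rewrite /wronskian'; ring.
Qed.

Lemma wronskianE t : X1 t * Y2 t - Y1 t * X2 t = K t.
Proof. exact: erefl. Qed.

Lemma dot_sym s t : dot s t = dot t s. Proof. by rewrite /tangent_dot; ring. Qed.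
Lemma cross_sym s t : cross s t = - cross t s. Proof. by rewrite /tangent_cross; ring. Qed.

Lemma cross_base s0 s t :
  dot s0 s0 * cross s t = dot s0 s * cross s0 t - cross s0 s * dot s0 t.
Proof. by rewrite /tangent_dot /tangent_cross; ring. Qed.

Lemma is_derive_cross (s0 t : R) :
  is_derive t 1 (cross s0) (X1 s0 * Y2 t - Y1 s0 * X2 t).
Proof. exact: is_derB (is_derZ _ (is_derive_Y1 t)) (is_derZ _ (is_derive_X1 t)). Qed.

Lemma is_derive_dot (s0 t : R) :
  is_derive t 1 (dot s0) (X1 s0 * X2 t + Y1 s0 * Y2 t).
Proof. exact: is_derD (is_derZ _ (is_derive_X1 t)) (is_derZ _ (is_derive_Y1 t)). Qed.

Section Regular.
Hypothesis generic_f : generic f.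

Lemma dot_gt0 t : 0 < dot t t.
Proof.
have := generic_regular generic_f t; rewrite velocityE /tangent_dot -!expr2 => h.
rewrite lt_def addr_ge0 ?sqr_ge0// andbT; apply: contra h.
by rewrite paddr_eq0 ?sqr_ge0// !sqrf_eq0 => /andP[/eqP -> /eqP ->].
Qed.

Lemma speed_gt0 t : 0 < speed t.
Proof. by rewrite sqrtr_gt0 dot_gt0. Qed.

Lemma speed2 t : speed t ^+ 2 = dot t t.
Proof. by rewrite sqr_sqrtr// ltW// dot_gt0. Qed.

Lemma curvatureE t : curvature f t = K t / speed t ^+ 3.
Proof.
by rewrite /curvature velocityE accelerationE /tangent_speed /tangent_dot /enorm !expr2.
Qed.

Lemma curvature_eq0 t : (curvature f t == 0) = (K t == 0).
Proof.
by rewrite curvatureE mulf_eq0 invr_eq0 expf_eq0 /= (gt_eqF (speed_gt0 t)) orbF.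
Qed.

Lemma smooth_speed : Cinf setT speed.
Proof.
apply: Cinf_sqrt; first by move=> x _; exact: dot_gt0.
by apply: CinfD; apply: CinfM; try exact: smooth_X1; exact: smooth_Y1.
Qed.

Lemma K0_inflexion t : K t = 0 -> inflexion f t.
Proof.
move=> Kt; apply: contrapT => nI; apply: (@generic_undulation _ _ generic_f t).
by split => //; apply/eqP; rewrite curvature_eq0 Kt.
Qed.

(** A zero of the curvature is an inflexion, since f has no undulation points,
    and a non-degenerate inflexion is a simple zero. *)
Lemma K'_neq0 t : K t = 0 -> wronskian' t != 0.
Proof.
by move=> /K0_inflexion /(generic_inflexion generic_f); rewrite velocityE third_derivativeE.
Qed.

(** Transversality of the crossings provides f s <> f t, which is part of the
    notion of a parallel pair. *)
Lemma parallel_not_both s t : distinct_on_circle s t -> cross s t = 0 ->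
  K s = 0 -> K t = 0 -> False.
Proof.
move=> dst st0 Ks Kt.
have pst : parallel_pair f s t.
  split; last by rewrite crossE.
  move=> E; have := generic_crossing generic_f dst E.
  by rewrite crossE st0 eqxx.
by case: (generic_parallel generic_f pst); apply; exact: K0_inflexion.
Qed.

(** cross s0 / dot s0 is the slope of the tangent line in coordinates with first
    axis f' s0, so it turns at the rate of the curvature.  It reduces questions on
    parallel tangents to calculus in one variable. *)
Lemma is_derive_slope (s0 t : R) : dot s0 t != 0 ->
  is_derive t 1 (fun u => cross s0 u / dot s0 u)
    (dot s0 s0 * K t / dot s0 t ^+ 2).
Proof.
move=> q0.
have D := is_derM (is_derive_cross s0 t) (is_derV q0 (is_derive_dot s0 t)).
apply: (is_derive_ext D).
by move: q0; rewrite /wronskian /tangent_dot /tangent_cross => q0; field.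
Qed.

Lemma dot_pos_near s0 : exists2 d, 0 < d & forall t, oball s0 d t -> 0 < dot s0 t.
Proof.
apply: nbhs_oball.
exact: (cvgr_gt (dot s0 s0) (is_der_continuous (is_derive_dot s0 s0)) _ (dot_gt0 s0)).
Qed.

Lemma slope_eq s0 s t : 0 < dot s0 s -> 0 < dot s0 t ->
  (cross s t == 0) = (cross s0 s / dot s0 s == cross s0 t / dot s0 t).
Proof.
move=> qs qt; transitivity (dot s0 s0 * cross s t == 0).
  by rewrite mulf_eq0 (gt_eqF (dot_gt0 s0)).
rewrite cross_base subr_eq0 (eqr_div _ _ (lt0r_neq0 qs) (lt0r_neq0 qt)) eq_sym.
by rewrite [cross s0 t * _]mulrC.
Qed.

(** Rolle: the tangent direction can come back to itself on a short arc only
    if the curvature vanishes in between. *)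
Lemma short_parallel_pair s0 : exists2 d, 0 < d & forall s t,
  oball s0 d s -> oball s0 d t -> s < t -> cross s t = 0 ->
  exists x, [/\ s < x, x < t & K x = 0].
Proof.
have [d d0 qpos] := dot_pos_near s0; exists d => // s t Bs Bt st /eqP.
rewrite (slope_eq (qpos _ Bs) (qpos _ Bt)) => /eqP E.
have B x : s <= x <= t -> dot s0 x != 0.
  by move=> sxt; rewrite gt_eqF// qpos//; exact: oball_sub Bs Bt sxt.
have [||x] := @Rolle R (fun u => cross s0 u / dot s0 u) s t st _ _ E.
- move=> x; rewrite in_itv /= => /andP[sx xt].
  have sxt : s <= x <= t by rewrite !ltW.
  by have [] := is_derive_slope (B x sxt).
- apply: continuous_in_subspaceT => x; rewrite inE /= in_itv /= => sxt.
  exact: is_der_continuous (is_derive_slope (B x sxt)).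
rewrite in_itv /= => /andP[sx xt] [_ dx]; exists x; split => //.
have q0 : dot s0 x != 0 by rewrite B// !ltW.
have [_] := is_derive_slope q0; rewrite dx => /eqP; rewrite eq_sym.
rewrite mulf_eq0 invr_eq0 expf_eq0 /= (negbTE q0) orbF mulf_eq0.
by rewrite gt_eqF ?dot_gt0//= => /eqP.
Qed.

Lemma K_sign z : K z = 0 -> exists2 d, 0 < d & forall x, oball z d x ->
  exists2 c, 0 < c & K x * wronskian' z = c * (x - z).
Proof.
move=> Kz; have /is_derive1_caratheodory [S [SE cS S0]] := is_derive_K z.
have K'z := K'_neq0 Kz.
have c2 : {for z, continuous (fun x => S x * wronskian' z)}.
  by apply: continuousM => //; exact: cvg_cst.
have pos : 0 < S z * wronskian' z by rewrite S0 -expr2 exprn_even_gt0.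
have [d d0 dP] := nbhs_oball (cvgr_gt (S z * wronskian' z) c2 _ pos).
exists d => // x Bx; exists (S x * wronskian' z); first exact: dP.
by have := SE x; rewrite Kz subr0 => ->; ring.
Qed.

Lemma K_isolated z : exists2 d, 0 < d & forall x, oball z d x -> K x = 0 -> x = z.
Proof.
have [Kz|Kz] := eqVneq (K z) 0; last first.
  have cKz : {for z, continuous K} by exact: is_der_continuous (is_derive_K z).
  have [d d0 dP] := nbhs_oball (cvgr_neq0 (K z) cKz Kz).
  by exists d => // x /dP /= /eqP h /h.
have [d d0 dP] := K_sign Kz; exists d => // x /dP[c c0].
move=> + Kx; rewrite Kx mul0r => /esym/eqP.
by rewrite mulf_eq0 (gt_eqF c0) /= subr_eq0 => /eqP.
Qed.

End Regular.
End GenericCurve.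

(** * Curvatures at the ends of a parallel pair *)

Section Isolation.
Context {R : realType}.
Variable f : R -> R * R.
Hypothesis closed_f : closed_smooth_curve f.
Hypothesis generic_f : generic f.
Local Notation X1 := (fx1 f).
Local Notation Y1 := (fy1 f).
Local Notation X2 := (fx2 f).
Local Notation Y2 := (fy2 f).
Local Notation K := (wronskian f).
Local Notation K' := (wronskian' f).
Local Notation cross := (tangent_cross f).
Local Notation dot := (tangent_dot f).
Local Notation speed := (tangent_speed f).
Local Notation kap := (curvature f).

Lemma smooth_curvature : Cinf setT kap.
Proof.
have s0 t := speed_gt0 closed_f generic_f t.
have cs := smooth_speed closed_f generic_f.
have -> : kap = fun t => K t * (speed t * (speed t * speed t))^-1.
  by apply/funext => t; rewrite curvatureE// -!exprS.
apply: CinfM; first exact: smooth_K.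
apply: Cinf_inv; first by move=> x _; rewrite !mulf_neq0// gt_eqF.
by apply: CinfM => //; exact: CinfM.
Qed.

(** Curvature does not depend on the parameter, up to the sign of the direction;
    this moves conditions on arc length parameterizations to the parameter of f. *)
Lemma arclength_exists s (sg : R) : sg = 1 \/ sg = -1 ->
  exists phi, [/\ arclength_change f s phi,
    derive1 (f \o phi) 0 = (sg / speed s) *: derive1 f s,
    curvature (f \o phi) 0 = sg * kap s &
    derive1 (curvature (f \o phi)) 0 = derive1 kap s / speed s].
Proof.
move=> sgE; have sg2 : sg ^+ 2 = 1 by case: sgE => ->; rewrite ?sqrrN expr1n.
have sp t : 0 < speed t by exact: speed_gt0.
have [phi [e [e0 phi0 cphi dphi]]] :=
  unit_speed_change s (smooth_speed closed_f generic_f) sp sgE.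
pose w t := sg / speed t.
have cw : Cinf setT w.
  apply: CinfM; first exact: Cinf_cst.
  apply: Cinf_inv; last exact: smooth_speed.
  by move=> x _; rewrite gt_eqF.
set U := oball 0 e in cphi dphi; have oU : open U by exact: open_oball.
have U0 : U 0 by exact: oball_center.
pose g := f \o phi.
have c1 : Cinf U (fst \o g) by apply: (Cinf_comp _ (smooth_X closed_f) cphi).
have c2 : Cinf U (snd \o g) by apply: (Cinf_comp _ (smooth_Y closed_f) cphi).
have comp (F F' : R -> R) : (forall t : R, is_derive t 1 F (F' t)) ->
    forall x, U x -> is_derive x 1 (fun y => F (phi y)) (F' (phi x) * w (phi x)).
  by move=> dF x Ux; exact: is_der_comp (dF _) (dphi x Ux).
have dw (t : R) : is_derive t 1 w (derive1 w t) by exact: Cinf_is_derive cw I.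
have g1 x : U x -> g^`() x = (X1 (phi x) * w (phi x), Y1 (phi x) * w (phi x)).
  move=> Ux; rewrite (derive1_pair oU c1 c2 Ux); congr (_, _); apply: derive1_val.
    exact: comp (is_derive_X closed_f) x Ux.
  exact: comp (is_derive_Y closed_f) x Ux.
pose snd_der (F1 F2 : R -> R) x := (F2 (phi x) * w (phi x)) * w (phi x) +
   F1 (phi x) * (derive1 w (phi x) * w (phi x)).
have g2 x : U x -> g^`(2) x = (snd_der X1 X2 x, snd_der Y1 Y2 x).
  move=> Ux; rewrite (derive1n_plane 2 oU c1 c2 Ux).
  have aux (F F1 F2 : R -> R) : (forall t : R, is_derive t 1 F (F1 t)) ->
     (forall t : R, is_derive t 1 F1 (F2 t)) ->
     (fun y => F (phi y))^`(2) x = snd_der F1 F2 x.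
    move=> dF dF1; rewrite derive1nS derive1n1.
    rewrite (@derive1_eq_on _ _ _ _ (fun y => F1 (phi y) * w (phi y)) _ oU Ux).
      by apply: derive1_val; exact: is_derM (comp _ _ dF1 x Ux) (comp _ _ dw x Ux).
    by move=> y Uy; apply: derive1_val; exact: comp.
  congr (_, _).
    exact: aux (is_derive_X closed_f) (is_derive_X1 closed_f).
  exact: aux (is_derive_Y closed_f) (is_derive_Y1 closed_f).
have w2 t : dot t t * w t ^+ 2 = 1.
  rewrite -(speed2 closed_f generic_f) /w expr_div_n sg2 mulrCA mulfV ?mulr1//.
  by rewrite expf_neq0// gt_eqF.
have unit x : Num.sqrt ((X1 (phi x) * w (phi x)) ^+ 2 +
                 (Y1 (phi x) * w (phi x)) ^+ 2) = 1.
  have dotE t : X1 t ^+ 2 + Y1 t ^+ 2 = dot t t by rewrite /tangent_dot !expr2.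
  by rewrite (exprMn _ (X1 _) (w _)) (exprMn _ (Y1 _) (w _)) -mulrDl dotE w2 sqrtr1.
have curvE x : U x -> curvature g x = sg * kap (phi x).
  move=> Ux; rewrite (curvature_plane oU c1 c2 Ux (g1 x Ux) (g2 x Ux)) unit.
  rewrite expr1n divr1 (curvatureE closed_f) /snd_der.
  have -> : sg * (K (phi x) / speed (phi x) ^+ 3) = K (phi x) * w (phi x) ^+ 3.
    rewrite /w expr_div_n; have -> : sg ^+ 3 = sg by rewrite exprS sg2 mulr1.
    by rewrite mulrCA mulrA.
  rewrite /wronskian; move: (derive1 w (phi x)) (w (phi x)) (phi x) => dwx wx u.
  by ring.
exists phi; split.
- split => //; exists U; split => //; first exact/Cinf_smooth_on.
  by move=> x Ux; rewrite g1// /enorm /= unit.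
- by rewrite g1// phi0 velocityE// /w /GRing.scale /= /scale_pair /=
    /GRing.scale /= [X1 s * _]mulrC [Y1 s * _]mulrC.
- by have := curvE 0 U0; rewrite phi0.
- have dk (t : R) : is_derive t 1 kap (derive1 kap t).
    by have := @Cinf_is_derive R setT kap t smooth_curvature I.
  have dgk := is_derZ sg (comp _ _ dk 0 U0).
  rewrite phi0 /w mulrCA [sg * (sg / _)]mulrA -expr2 sg2 mul1r in dgk.
  exact: (derive1_val (@is_derive_eq_on R U _ (curvature g) 0 _ oU U0
    (fun y Uy => esym (curvE y Uy)) dgk)).
Qed.

Lemma lagrange_identity s t : dot s t ^+ 2 + cross s t ^+ 2 = dot s s * dot t t.
Proof. by rewrite /tangent_dot /tangent_cross; ring. Qed.

Lemma dot_neq0 s t : cross s t = 0 -> dot s t != 0.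
Proof.
move=> st0; have := lagrange_identity s t; rewrite st0 expr0n addr0 => E.
rewrite -sqrf_eq0 E mulf_neq0// gt_eqF//; exact: dot_gt0.
Qed.

Lemma dot_speed s t (sg : R) : sg = 1 \/ sg = -1 -> cross s t = 0 ->
  0 < sg * dot s t -> dot s t = sg * (speed s * speed t).
Proof.
move=> sgE st0 pos; have sg2 : sg * sg = 1 by case: sgE => ->; rewrite ?mulrNN mulr1.
have sp t' : 0 < speed t' by exact: speed_gt0.
suff : sg * dot s t = speed s * speed t by move=> <-; rewrite mulrA sg2 mul1r.
apply/eqP; rewrite -(@eqrXn2 _ 2) ?ltW// ?mulr_gt0//; apply/eqP.
have := lagrange_identity s t; rewrite st0 expr0n addr0 !exprMn !speed2// => ->.
by rewrite expr2 sg2 mul1r.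
Qed.

(** Where f' s = mu *: f' t, this says that the signed curvatures at s and t,
    taken in a common direction, agree: K s = mu^3 * K t. *)
Definition equal_curvatures s t : Prop :=
  K s * dot t t ^+ 3 = dot s t ^+ 3 * K t.

Lemma equal_curvaturesP s t (sg : R) : sg = 1 \/ sg = -1 -> cross s t = 0 ->
  0 < sg * dot s t -> equal_curvatures s t -> kap s = sg * kap t.
Proof.
move=> sgE st0 pos; rewrite /equal_curvatures (dot_speed sgE st0 pos).
have := @speed_gt0 _ _ closed_f generic_f; move=> sp.
rewrite -!speed2// !curvatureE// => E.
have a0 := lt0r_neq0 (sp s); have b0 := lt0r_neq0 (sp t).
have sg3 : sg ^+ 3 = sg by case: sgE => ->; rewrite ?expr1n// !exprS expr0; ring.
move: (K s) (K t) (speed s) (speed t) a0 b0 E => k1 k2 a b a0 b0 E.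
have -> : k1 = (sg * (a * b)) ^+ 3 * k2 / (b ^+ 2) ^+ 3.
  by rewrite -E mulfK// !expf_neq0.
by rewrite !exprMn sg3; field; rewrite a0 b0.
Qed.

Lemma is_derive_cross_parallel s t : cross s t = 0 ->
  dot t t * (X1 s * Y2 t - Y1 s * X2 t) = dot s t * K t.
Proof.
move=> st0; apply/eqP; rewrite -subr_eq0; apply/eqP.
rewrite -[RHS](mul0r (X1 t * X2 t + Y1 t * Y2 t)) -st0.
by rewrite /tangent_dot /tangent_cross /wronskian; ring.
Qed.

(** By Rolle the curvature vanishes somewhere between s and t; its zeros being
    isolated, that zero is s0, and being simple, K has opposite signs at s and t. *)
Lemma near_diagonal s0 : exists2 d, 0 < d & forall s t, oball s0 d s ->
  oball s0 d t -> s != t -> cross s t = 0 ->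
  [/\ K s0 = 0, (s - s0) * (t - s0) < 0, K s * K t < 0 & 0 < dot s t].
Proof.
have [d1 d10 P1] := short_parallel_pair closed_f generic_f s0.
have [d2 d20 P2] := K_isolated closed_f generic_f s0.
have [d3 d30 P3] := dot_pos_near closed_f generic_f s0.
have [d4 d40 P4] : exists2 d, 0 < d & K s0 = 0 -> forall x, oball s0 d x ->
    exists2 c, 0 < c & K x * K' s0 = c * (x - s0).
  have [K0|/eqP h] := eqVneq (K s0) 0.
    by have [d d0 Pd] := K_sign closed_f generic_f K0; exists d.
  by exists 1 => // /h.
pose d := Num.min (Num.min d1 d2) (Num.min d3 d4).
have sub x : oball s0 d x ->
    [/\ oball s0 d1 x, oball s0 d2 x, oball s0 d3 x & oball s0 d4 x].
  move=> /oballP; rewrite /d !lt_min => /andP[/andP[? ?] /andP[? ?]].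
  by split; apply/oballP.
exists d; first by rewrite /d !lt_min d10 d20 d30.
have main s t : oball s0 d s -> oball s0 d t -> s < t -> cross s t = 0 ->
    [/\ K s0 = 0, (s - s0) * (t - s0) < 0, K s * K t < 0 & 0 < dot s t].
  move=> /sub[s1 s2 s3 s4] /sub[t1 t2 t3 t4] st st0.
  have [x [sx xt Kx]] := P1 s t s1 t1 st st0.
  have xs : x = s0.
    by apply: P2 => //; apply: oball_sub s2 t2 _; rewrite !ltW.
  subst x; have neg : (s - s0) * (t - s0) < 0.
    by rewrite pmulr_llt0 ?subr_gt0// subr_lt0.
  split=> //.
    have [c c0 Ec] := P4 Kx _ s4; have [c' c'0 Ec'] := P4 Kx _ t4.
    have K'0 := K'_neq0 closed_f generic_f Kx.
    move: (K s) (K t) (K' s0) Ec Ec' K'0 => k1 k2 k3 Ec Ec' k30.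
    have L : k1 * k2 * k3 ^+ 2 < 0.
      have -> : k1 * k2 * k3 ^+ 2 = (k1 * k3) * (k2 * k3) by ring.
      have -> : (k1 * k3) * (k2 * k3) = (c * c') * ((s - s0) * (t - s0)).
        by rewrite Ec Ec'; ring.
      by rewrite pmulr_rlt0// mulr_gt0.
    by move: L; rewrite pmulr_llt0// exprn_even_gt0.
  have E : dot t t * dot s0 s = dot s t * dot s0 t.
    apply/eqP; rewrite -subr_eq0; apply/eqP.
    rewrite -[RHS](mul0r (cross s0 t)) -st0 /tangent_dot /tangent_cross; ring.
  have L : 0 < dot s t * dot s0 t.
    by rewrite -E; apply: mulr_gt0; [exact: dot_gt0|exact: P3].
  by move: L; rewrite pmulr_lgt0// P3.
move=> s t Bs Bt; rewrite neq_lt => /orP[st|ts] st0; first exact: main.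
rewrite cross_sym in st0; move/eqP: st0; rewrite oppr_eq0 => /eqP ts0.
have [h1 h2 h3 h4] := main t s Bt Bs ts ts0.
split; [exact: h1|rewrite mulrC; exact: h2|rewrite mulrC; exact: h3|].
by rewrite dot_sym; exact: h4.
Qed.

Lemma cross_int (m : int) s t : cross s (t + m%:~R) = cross s t.
Proof. by rewrite /tangent_cross X1_int// Y1_int. Qed.

Lemma dot_int (m : int) s t : dot s (t + m%:~R) = dot s t.
Proof. by rewrite /tangent_dot X1_int// Y1_int. Qed.

Lemma near_fst (P : set R) (p : R * R) : nbhs p.1 P -> \forall q \near p, P q.1.
Proof. by move=> hP; apply: (cvg_fst (F := nbhs p.1) (G := nbhs p.2)). Qed.

Lemma near_snd (P : set R) (p : R * R) : nbhs p.2 P -> \forall q \near p, P q.2.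
Proof. by move=> hP; apply: (cvg_snd (F := nbhs p.1) (G := nbhs p.2)). Qed.

Lemma distinctPn (s t : R) : ~ distinct_on_circle s t -> exists m : int, t + m%:~R = s.
Proof.
rewrite /distinct_on_circle => /negP; rewrite negbK => /intrP[m E].
by exists m; rewrite -E addrC subrK.
Qed.

Lemma distinct_int (m : int) (s t : R) : distinct_on_circle s t -> s != t + m%:~R.
Proof.
rewrite /distinct_on_circle; apply: contraNneq => ->.
by rewrite addrC addKr; apply/intrP; exists m.
Qed.

Lemma near_diagonal_torus (p : R * R) : ~ distinct_on_circle p.1 p.2 ->
  \forall q \near p, distinct_on_circle q.1 q.2 -> cross q.1 q.2 = 0 ->
  K q.1 * K q.2 < 0 /\ 0 < dot q.1 q.2.
Proof.
move=> /distinctPn[m E]; have [d d0 P] := near_diagonal p.1.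
have n1 := near_fst (oball_nbhs p.1 d0).
have n2 : \forall q \near p, oball p.1 d (q.2 + m%:~R).
  have [e e0 he] : exists2 e, 0 < e & forall t, oball p.2 e t -> oball p.1 d (t + m%:~R).
    exists d => // t /oballP tp; apply/oballP; rewrite -E.
    by have -> : t + m%:~R - (p.2 + m%:~R) = t - p.2 by ring.
  by apply: filterS (near_snd (oball_nbhs p.2 e0)) => q; exact: he.
near=> q => dq cq.
have B1 : oball p.1 d q.1 by near: q.
have B2 : oball p.1 d (q.2 + m%:~R) by near: q.
have := P _ _ B1 B2 (distinct_int m dq).
by rewrite cross_int dot_int K_int// => /(_ cq) [_ _ ? ?].
Unshelve. all: by end_near. Qed.

Lemma Cinf_along_fst (F : R -> R) (p : R * R) : Cinf setT F ->
  {for p, continuous (fun q : R * R => F q.1)}.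
Proof.
move=> cF; apply: (continuous_comp (f := fst) (g := F)).
  exact: continuous_fst.
exact: Cinf_continuous cF I.
Qed.

Lemma Cinf_along_snd (F : R -> R) (p : R * R) : Cinf setT F ->
  {for p, continuous (fun q : R * R => F q.2)}.
Proof.
move=> cF; apply: (continuous_comp (f := snd) (g := F)).
  exact: continuous_snd.
exact: Cinf_continuous cF I.
Qed.

Lemma cross_cont (p : R * R) :
  {for p, continuous (fun q : R * R => cross q.1 q.2)}.
Proof.
have a := smooth_X1 closed_f; have b := smooth_Y1 closed_f.
by apply: continuousB; apply: continuousM; by [exact: Cinf_along_fst|exact: Cinf_along_snd].
Qed.

Lemma dot_cont (p : R * R) : {for p, continuous (fun q : R * R => dot q.1 q.2)}.
Proof.
have a := smooth_X1 closed_f; have b := smooth_Y1 closed_f.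
by apply: continuousD; apply: continuousM; by [exact: Cinf_along_fst|exact: Cinf_along_snd].
Qed.

Definition singular_pairs : set (R * R) := [set p |
  [/\ distinct_on_circle p.1 p.2, cross p.1 p.2 = 0 & equal_curvatures p.1 p.2]].

Definition inflexion_pairs : set (R * R) := [set p |
  [/\ distinct_on_circle p.1 p.2, cross p.1 p.2 = 0 & K p.1 * K p.2 = 0]].

(** When the end t is not an inflexion, the tangent direction turns at t with
    nonzero speed, so it leaves that of the fixed end s. *)
Lemma parallel_rigid s t : cross s t = 0 -> K t != 0 ->
  exists2 d, 0 < d & forall u, oball t d u -> cross s u = 0 -> u = t.
Proof.
move=> st0 Kt.
have /is_derive1_caratheodory [S [SE cS S0]] := is_derive_cross closed_f s t.
have T0 : X1 s * Y2 t - Y1 s * X2 t != 0.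
  have := is_derive_cross_parallel st0; apply: contra_eq_neq => ->.
  by rewrite mulr0 eq_sym mulf_neq0// dot_neq0.
rewrite -S0 in T0; have [d d0 P] := nbhs_oball (cvgr_neq0 (S t) cS T0).
exists d => // u /P /= Su0 E; have := SE u; rewrite E st0 subrr => /esym/eqP.
by rewrite mulf_eq0 (negbTE Su0) subr_eq0 => /eqP.
Qed.

Lemma mulf_eq0_left (a b : R) : a * b = 0 -> b != 0 -> a = 0.
Proof. by move=> /eqP; rewrite mulf_eq0 => /orP[/eqP //|/eqP -> /eqP]. Qed.

Lemma pair_ext (p q : R * R) : q.1 = p.1 -> q.2 = p.2 -> q = p.
Proof. by case: p q => [? ?] [? ?] /= -> ->. Qed.

(* Nor inside these. *)
Opaque wronskian wronskian' Defs.curvature tangent_cross tangent_dot tangent_speed.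

(** Only one end is an inflexion; it is isolated among the inflexions, and once it
    is fixed the other end is isolated by parallel_rigid. *)
Lemma inflexion_pairs_isolated (p : R * R) : \forall q \near p, inflexion_pairs q -> q = p.
Proof.
have [dp|ndp] := pselect (distinct_on_circle p.1 p.2); last first.
  near=> q => -[dq cq Kq].
  suff [] : K q.1 * K q.2 < 0 /\ 0 < dot q.1 q.2 by rewrite Kq ltxx.
  by move: dq cq; near: q; exact: near_diagonal_torus.
have [c0|c0] := eqVneq (cross p.1 p.2) 0; last first.
  near=> q => -[_ /eqP cq _].
  suff : cross q.1 q.2 != 0 by rewrite cq.
  by near: q; exact: (cvgr_neq0 (cross p.1 p.2) (@cross_cont p) c0).
have Knear s : K s != 0 -> nbhs s [set x | K x != 0].
  move=> Ks; have cKs := is_der_continuous (is_derive_K closed_f s).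
  exact: (cvgr_neq0 (K s) cKs Ks).
have [d1 d10 P1] := K_isolated closed_f generic_f p.1.
have [d2 d20 P2] := K_isolated closed_f generic_f p.2.
have n1 := near_fst (oball_nbhs p.1 d10).
have n2 := near_snd (oball_nbhs p.2 d20).
have [K1|K1] := eqVneq (K p.1) 0.
  have K2 : K p.2 != 0.
    by apply/eqP => K2; apply: (parallel_not_both closed_f generic_f dp c0 K1 K2).
  have Kn2 := Knear _ K2.
  have n3 : \forall q \near p, K q.2 != 0 by exact: near_snd Kn2.
  have [d d0 P] := parallel_rigid c0 K2.
  have n4 := near_snd (oball_nbhs p.2 d0).
  near=> q => -[_ cq Kq]; have Kq2 : K q.2 != 0 by near: q.
  have B1 : oball p.1 d1 q.1 by near: q.
  have B2 : oball p.2 d q.2 by near: q.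
  have Kq1 : K q.1 = 0 := mulf_eq0_left Kq Kq2.
  have E1 := P1 _ B1 Kq1.
  rewrite E1 in cq; have E2 := P _ B2 cq.
  exact: pair_ext E1 E2.
have Kn1 := Knear _ K1.
have n3 : \forall q \near p, K q.1 != 0 by exact: near_fst Kn1.
have c0' : cross p.2 p.1 = 0 by rewrite cross_sym c0 oppr0.
have [d d0 P] := parallel_rigid c0' K1.
have n4 := near_fst (oball_nbhs p.1 d0).
near=> q => -[_ cq Kq]; have Kq1 : K q.1 != 0 by near: q.
have B1 : oball p.1 d q.1 by near: q.
have B2 : oball p.2 d2 q.2 by near: q.
have Kq2 : K q.2 = 0 by apply: mulf_eq0_left Kq1; rewrite mulrC.
have E2 := P2 _ B2 Kq2.
rewrite E2 cross_sym in cq; have E1 := P _ B1 (oppr_inj (etrans cq (esym (oppr0 _)))).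
exact: pair_ext E1 E2.
Unshelve. all: by end_near. Qed.

End Isolation.

(** * Isolation of the singular pairs *)

Section SingularIsolation.
Context {R : realType}.
Variable f : R -> R * R.
Hypothesis closed_f : closed_smooth_curve f.
Hypothesis generic_f : generic f.
Local Notation X1 := (fx1 f).
Local Notation Y1 := (fy1 f).
Local Notation X2 := (fx2 f).
Local Notation Y2 := (fy2 f).
Local Notation K := (wronskian f).
Local Notation K' := (wronskian' f).
Local Notation cross := (tangent_cross f).
Local Notation dot := (tangent_dot f).
Local Notation speed := (tangent_speed f).
Local Notation kap := (curvature f).

Lemma eq_divl (c x y : R) : c != 0 -> c * x = y -> x = y / c.
Proof. by move=> c0 <-; rewrite mulrC mulKf. Qed.

(** The genericity condition on the derivatives of the curvatures, read in the
    parameter of f; reversing the second curve when sg = -1 changes the sign of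
    its curvature but not of the derivative of the curvature. *)
Lemma curvature_rates (s t sg : R) : sg = 1 \/ sg = -1 ->
  distinct_on_circle s t -> cross s t = 0 -> 0 < sg * dot s t ->
  kap s = sg * kap t -> derive1 kap s / speed s <> derive1 kap t / speed t.
Proof.
move=> sgE dst st0 pos kE.
have pst : parallel_pair f s t.
  split; last by rewrite crossE.
  move=> E; have := generic_crossing generic_f dst E.
  by rewrite crossE// st0 eqxx.
have [phi [aphi dphi kphi e1]] :=
  arclength_exists closed_f generic_f s (or_introl (erefl (1 : R))).
have [psi [apsi dpsi kpsi e2]] := arclength_exists closed_f generic_f t sgE.
move=> AB; have eAB := etrans e1 (etrans AB (esym e2)).
have ek : curvature (f \o phi) 0 = curvature (f \o psi) 0.
  by rewrite kphi kpsi mul1r.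
suff dir : same_direction (derive1 (f \o phi) 0) (derive1 (f \o psi) 0).
  exact: (generic_curvature generic_f dst pst aphi apsi dir ek eAB).
exists 1; first exact: ltr01.
rewrite scale1r; apply: (etrans dphi (etrans _ (esym dpsi))).
rewrite (velocityE closed_f s) (velocityE closed_f t).
have E := dot_speed closed_f generic_f sgE st0 pos.
have sg2 : sg * sg = 1 by case: sgE => ->; rewrite ?mulrNN mulr1.
have D2 : speed t ^+ 2 = dot t t by exact: speed2.
have a0 := lt0r_neq0 (speed_gt0 closed_f generic_f s).
have b0 := lt0r_neq0 (speed_gt0 closed_f generic_f t).
have eX : dot t t * X1 s = dot s t * X1 t.
  apply/eqP; rewrite -subr_eq0; apply/eqP.
  by rewrite -[RHS](mul0r (Y1 t)) -st0 /tangent_dot /tangent_cross; ring.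
have eY : dot t t * Y1 s = dot s t * Y1 t.
  apply/eqP; rewrite -subr_eq0; apply/eqP.
  by rewrite -[RHS](mul0r (- X1 t)) -st0 /tangent_dot /tangent_cross; ring.
have aux (x y : R) : dot t t * x = dot s t * y ->
    1 / speed s * x = sg / speed t * y.
  rewrite -D2 E; move: (speed s) (speed t) a0 b0 => a b a0 b0 h.
  have -> : x = sg * (a * b) * y / b ^+ 2 by exact: eq_divl (expf_neq0 2 b0) h.
  by field; rewrite a0 b0.
by congr (_, _); [exact: aux eX|exact: aux eY].
Qed.

Lemma linear_system (al be ga de u v : R) : al * v = be * u -> ga * u = de * v ->
  be * de - ga * al != 0 -> u = 0 /\ v = 0.
Proof.
move=> E1 E2 D0; split; apply/eqP; rewrite -(mulrI_eq0 _ (lregP D0)); apply/eqP.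
  transitivity (de * (be * u) - al * (ga * u)); first by ring.
  by rewrite -E1 E2; ring.
transitivity (be * (de * v) - ga * (al * v)); first by ring.
by rewrite -E2 E1; ring.
Qed.

Lemma continuous_along_fst (F : R -> R) (p : R * R) : {for p.1, continuous F} ->
  {for p, continuous (fun q : R * R => F q.1)}.
Proof. exact: (@continuous_comp _ _ _ fst F p (@continuous_fst R _ _ p)). Qed.

Lemma continuous_along_snd (F : R -> R) (p : R * R) : {for p.2, continuous F} ->
  {for p, continuous (fun q : R * R => F q.2)}.
Proof. exact: (@continuous_comp _ _ _ snd F p (@continuous_snd R _ _ p)). Qed.

(** The left-hand side is the Jacobian at a singular pair of the equations
    cross s t = 0 and kap s = sg * kap t.  It is a nonzero multiple of the
    difference of the derivatives of the two curvatures by arc length. *)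
Lemma transversality (sg a b d11 d22 d12 k1 k2 tau r1 r2 : R) :
  sg = 1 \/ sg = -1 -> a != 0 -> b != 0 -> k2 != 0 ->
  a ^+ 2 = d11 -> b ^+ 2 = d22 -> d12 = sg * (a * b) ->
  k1 * d22 ^+ 3 = d12 ^+ 3 * k2 -> d22 * tau = d12 * k2 -> r1 / a <> r2 / b ->
  d12 * k1 * (sg * r2) - r1 * (d11 * tau) != 0.
Proof.
move=> sgE a0 b0 k20 <- <- -> Ek Et rates.
have sg2 : sg ^+ 2 = 1 by case: sgE => ->; rewrite ?sqrrN expr1n.
have sg0 : sg != 0 by case: sgE => ->; rewrite ?oppr_eq0 oner_eq0.
have tauE : tau = sg * a / b * k2.
  have -> : tau = sg * (a * b) * k2 / b ^+ 2 by exact: eq_divl (expf_neq0 2 b0) Et.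
  by field; rewrite b0.
have k1E : k1 = sg * a ^+ 3 / b ^+ 3 * k2.
  have -> : k1 = (sg * (a * b)) ^+ 3 * k2 / (b ^+ 2) ^+ 3.
    by rewrite -Ek mulfK// !expf_neq0.
  have sg3 : sg ^+ 3 = sg by rewrite exprS sg2 mulr1.
  by rewrite !exprMn sg3; field; rewrite b0.
have -> : sg * (a * b) * k1 * (sg * r2) - r1 * (a ^+ 2 * tau) =
    sg * k2 * a ^+ 4 / b * (r2 / b - r1 / a).
  rewrite k1E tauE.
  have -> : sg * (a * b) * (sg * a ^+ 3 / b ^+ 3 * k2) * (sg * r2) =
    sg ^+ 2 * (sg * (a * b) * (a ^+ 3 / b ^+ 3 * k2) * r2) by ring.
  by rewrite sg2; field; rewrite a0 b0.
by rewrite !mulf_neq0 ?invr_neq0 ?expf_neq0// subr_eq0 eq_sym; exact/eqP.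
Qed.

(** Off the diagonal, Caratheodory's difference quotients turn the two equations
    satisfied by a nearby singular pair q into a homogeneous linear system for
    q - p, whose determinant Delta q is continuous and nonzero at p.  Near the
    diagonal the curvatures at the ends have opposite signs. *)
Lemma singular_pairs_isolated (p : R * R) :
  \forall q \near p, singular_pairs f q -> q = p.
Proof.
have [dp|ndp] := pselect (distinct_on_circle p.1 p.2); last first.
  near=> q => -[dq cq Eq].
  have [] : K q.1 * K q.2 < 0 /\ 0 < dot q.1 q.2.
    by move: dq cq; near: q; exact: near_diagonal_torus.
  have tt := dot_gt0 closed_f generic_f q.2.
  move: Eq; rewrite /equal_curvatures => Eq KK st; move: KK Eq st tt.
  move: (K q.1) (K q.2) (dot q.1 q.2) (dot q.2 q.2) => k1 k2 d12 d22 KK Eq st tt.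
  have : k1 * d22 ^+ 3 * k2 < 0 by rewrite mulrAC pmulr_llt0 ?exprn_gt0.
  by rewrite Eq -mulrA -expr2 ltNge mulr_ge0 ?sqr_ge0// exprn_ge0 ?ltW.
have [c0|c0] := eqVneq (cross p.1 p.2) 0; last first.
  near=> q => -[_ /eqP cq _].
  suff : cross q.1 q.2 != 0 by rewrite cq.
  by near: q; exact: (cvgr_neq0 (cross p.1 p.2) (@cross_cont _ _ closed_f p) c0).
pose E q : R := K q.1 * (dot q.2 q.2 * (dot q.2 q.2 * dot q.2 q.2)) -
  dot q.1 q.2 * (dot q.1 q.2 * dot q.1 q.2) * K q.2.
have EE q : equal_curvatures f q.1 q.2 <-> E q = 0.
  rewrite /equal_curvatures /E -!expr2 -!exprS; split => [->|/subr0_eq//].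
  by rewrite subrr.
have [E0|E0] := eqVneq (E p) 0; last first.
  have cE : {for p, continuous E}.
    have cd := @dot_cont _ _ closed_f p.
    have cdd : Cinf setT (fun t => dot t t).
      have a := smooth_X1 closed_f; have b := smooth_Y1 closed_f.
      by apply: CinfD; exact: CinfM.
    have cdd2 := @Cinf_along_snd R _ p cdd.
    apply: continuousB; apply: continuousM.
    - exact: (@Cinf_along_fst R _ p (smooth_K closed_f)).
    - apply: continuousM; [exact: cdd2|apply: continuousM; exact: cdd2].
    - apply: continuousM; [exact: cd|apply: continuousM; exact: cd].
    - exact: (@Cinf_along_snd R _ p (smooth_K closed_f)).
  near=> q => -[_ _ /EE/eqP Eq].
  suff : E q != 0 by rewrite Eq.
  by near: q; exact: (cvgr_neq0 (E p) cE E0).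
move/EE in E0.
have dn := dot_neq0 closed_f generic_f c0.
have [sg sgE pos] : exists2 sg : R, sg = 1 \/ sg = -1 & 0 < sg * dot p.1 p.2.
  case: (ltgtP (dot p.1 p.2) 0) dn => // h _.
    by exists (-1); [right|rewrite mulN1r oppr_gt0].
  by exists 1; [left|rewrite mul1r].
have kE := equal_curvaturesP closed_f generic_f sgE c0 pos E0.
have rates := curvature_rates sgE dp c0 pos kE.
have tt := dot_gt0 closed_f generic_f p.2.
have Kt : K p.2 != 0.
  apply/eqP => Kt; have Ks : K p.1 = 0.
    move: E0; rewrite /equal_curvatures Kt mulr0 => /eqP.
    by rewrite mulf_eq0 expf_eq0 /= (gt_eqF tt) orbF => /eqP.
  exact: (parallel_not_both closed_f generic_f dp c0 Ks Kt).
have /is_derive1_caratheodory [S [SE cS S0]] := is_derive_cross closed_f p.1 p.1.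
have /is_derive1_caratheodory [T [TE cT T0]] := is_derive_cross closed_f p.1 p.2.
have ck := smooth_curvature closed_f generic_f.
have dk (t : R) : is_derive t 1 kap (derive1 kap t).
  by have := @Cinf_is_derive R setT kap t ck Logic.I.
have /is_derive1_caratheodory [S' [SE' cS' S0']] := dk p.1.
have /is_derive1_caratheodory [T' [TE' cT' T0']] := dk p.2.
pose al (q : R * R) : R := dot p.1 q.1 * T q.2.
pose be (q : R * R) : R := dot p.1 q.2 * S q.1.
pose ga (q : R * R) : R := S' q.1.
pose de (q : R * R) : R := sg * T' q.2.
pose Delta (q : R * R) : R := be q * de q - ga q * al q.
have near_pos : \forall q \near p, 0 < sg * dot q.1 q.2.
  have cd : {for p, continuous (fun q : R * R => sg * dot q.1 q.2)}.
    by apply: continuousM; [exact: cvg_cst|exact: dot_cont].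
  exact: (cvgr_gt (sg * dot p.1 p.2) cd _ pos).
have D0 : Delta p != 0.
  rewrite /Delta /al /be /ga /de (etrans S0 (wronskianE f p.1)) T0 S0' T0'.
  exact: (transversality sgE
    (lt0r_neq0 (speed_gt0 closed_f generic_f p.1))
    (lt0r_neq0 (speed_gt0 closed_f generic_f p.2)) Kt
    (speed2 closed_f generic_f p.1) (speed2 closed_f generic_f p.2)
    (dot_speed closed_f generic_f sgE c0 pos) E0 (is_derive_cross_parallel c0) rates).
have cD : {for p, continuous Delta}.
  have cd t : {for t, continuous (dot p.1)} :=
    is_der_continuous (is_derive_dot closed_f p.1 t).
  have h1 := continuous_along_fst (cd p.1); have h2 := continuous_along_snd (cd p.2).
  have h3 := continuous_along_fst cS; have h4 := continuous_along_snd cT.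
  have h5 := continuous_along_fst cS'; have h6 := continuous_along_snd cT'.
  have hsg : {for p, continuous (fun=> sg : R)} by exact: cvg_cst.
  apply: continuousB; apply: continuousM.
  - apply: continuousM; [exact: h2|exact: h3].
  - apply: continuousM; [exact: hsg|exact: h6].
  - exact: h5.
  - apply: continuousM; [exact: h1|exact: h4].
have nD : \forall q \near p, Delta q != 0 by exact: (cvgr_neq0 (Delta p) cD D0).
near=> q => -[dq cq Eq].
have posq : 0 < sg * dot q.1 q.2 by near: q.
have kEq := equal_curvaturesP closed_f generic_f sgE cq posq Eq.
have Dq : Delta q != 0 by near: q.
have E1 : al q * (q.2 - p.2) = be q * (q.1 - p.1).
  have cb := cross_base f p.1 q.1 q.2; rewrite cq mulr0 in cb.
  have sq := SE q.1; have tq := TE q.2.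
  have pp : cross p.1 p.1 = 0 by rewrite /tangent_cross mulrC subrr.
  rewrite pp subr0 in sq; rewrite c0 subr0 in tq.
  move: cb; rewrite sq tq /al /be => /esym/subr0_eq => h.
  by rewrite -mulrA h mulrC mulrA.
have E2 : ga q * (q.1 - p.1) = de q * (q.2 - p.2).
  by rewrite /ga /de -SE' -mulrA -TE' kE kEq mulrBr.
have [u0 v0] := linear_system E1 E2 Dq.
by apply: pair_ext; apply/eqP; rewrite -subr_eq0 ?u0 ?v0.
Unshelve. all: by end_near. Qed.

End SingularIsolation.

(** * Finiteness and parity of sets of points *)

Section Counting.
Context {R : realType}.
Implicit Types (p q : R * R).

Definition swap p : R * R := (p.2, p.1).

Lemma swapK : involutive swap. Proof. by case. Qed.

Lemma finite_of_isolated (A : set (R * R)) :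
  (forall p, \forall q \near p, A q -> q = p) ->
  finite_set [set p | [/\ 0 <= p.1 < 1, 0 <= p.2 < 1 & A p]].
Proof.
move=> isoA; pose Q : set (R * R) := `[0, 1]%classic `*` `[0, 1]%classic.
have cQ : compact Q by apply: compact_setX; exact: segment_compact.
have ccQ : cover_compact Q by rewrite -(compact_cover ((R * R)%type : normedModType R)).
pose O p : set (R * R) := interior [set q | A q -> q = p].
have [] := ccQ _ setT O.
- by move=> p _; exact: open_interior.
- by move=> p _; exists p => //; exact: isoA.
move=> D _ QD; apply: (@sub_finite_set _ _ [set` D]); last exact: finite_fset.
move=> p /= [/andP[a0 a1] /andP[b0 b1] Ap].
have Qp : Q p by split => /=; rewrite in_itv /= ?a0 ?b0 ltW.
have [q Dq Oq] := QD p Qp.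
by have -> : p = q := (interior_subset Oq) Ap.
Qed.

(** Points below the diagonal are matched with points above it. *)
Lemma even_swap (F : {fset (R * R)%type}) :
  (forall p, p \in F -> swap p \in F) -> (forall p, p \in F -> p.1 != p.2) ->
  ~~ odd #|` F|%fset.
Proof.
move=> sF nd.
pose F1 := [fset p in F | p.1 < p.2]%fset.
have -> : F = (F1 `|` [fset swap p | p in F1])%fset.
  apply/fsetP => p; rewrite inE; apply/idP/orP => [pF|].
    have := nd p pF; rewrite neq_lt => /orP[h|h].
      by left; rewrite !inE pF.
    right; apply/imfsetP; exists (swap p); last by rewrite swapK.
    by rewrite /= !inE /= sF.
  case; first by rewrite !inE => /andP[].
  by move=> /imfsetP[q /=]; rewrite !inE => /andP[/sF ? _] ->.
rewrite cardfsU (_ : (F1 `&` _)%fset = fset0) ?cardfs0 ?subn0; last first.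
  apply/fsetP => p; rewrite !inE; apply/negP => /andP[/andP[_ h]].
  by move=> /imfsetP[q /=]; rewrite !inE => /andP[_ h'] E; move: h h'; rewrite E /=; lra.
rewrite [X in (_ + X)%N]card_imfset; last exact: (inv_inj swapK).
by rewrite addnn odd_double.
Qed.

Section PeriodicZeros.
(* s is the derivative of G, of which only the sign at the zeros of G matters. *)
Variables G s : R -> R.
Hypothesis cG : continuous G.
Hypothesis pG : forall t, G (t + 1) = G t.
Hypothesis ps : forall t, s (t + 1) = s t.
Hypothesis signG : forall z, G z = 0 -> exists2 d, 0 < d & forall x, oball z d x ->
  exists2 c, 0 < c & G x * s z = c * (x - z).

Lemma same_sign (a b : R) : a <= b -> (forall x, a <= x <= b -> G x != 0) ->
  0 < G a * G b.
Proof.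
move=> ab nz; rewrite ltNge; apply/negP => h.
have Ga := nz a; have Gb := nz b; rewrite !lexx !ab /= in Ga Gb.
have [||x] := @IVT R G a b 0 ab; first exact: continuous_subspaceT.
  move: (Ga isT) (Gb isT) h; rewrite ge_min le_max.
  case: (ltgtP (G a) 0) => // ha _; case: (ltgtP (G b) 0) => // hb _ //=.
    by rewrite leNgt nmulr_rgt0// hb.
  by rewrite leNgt mulr_gt0.
by rewrite in_itv /= => /nz /eqP.
Qed.

(** Just after z the function has the sign of s z, just before w it has the sign
    opposite to s w, and it keeps its sign in between. *)
Lemma consecutive_zeros (z w : R) : z < w -> G z = 0 -> G w = 0 ->
  (forall x, z < x < w -> G x != 0) -> s z * s w < 0.
Proof.
move=> zw Gz Gw nz.
have [d1 d10 P1] := signG Gz; have [d2 d20 P2] := signG Gw.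
pose e := Num.min (Num.min d1 d2) (w - z) / 3.
have m0 : 0 < Num.min (Num.min d1 d2) (w - z) by rewrite !lt_min d10 d20 subr_gt0.
have m1 : Num.min (Num.min d1 d2) (w - z) <= d1 by rewrite !ge_min lexx.
have m2 : Num.min (Num.min d1 d2) (w - z) <= d2 by rewrite !ge_min lexx orbT.
have m3 : Num.min (Num.min d1 d2) (w - z) <= w - z by rewrite ge_min lexx orbT.
have [c c0 E1] : exists2 c, 0 < c & G (z + e) * s z = c * (z + e - z).
  by apply: P1; rewrite /oball /= /e; apply/andP; split; lra.
have [c' c'0 E2] : exists2 c, 0 < c & G (w - e) * s w = c * (w - e - w).
  by apply: P2; rewrite /oball /= /e; apply/andP; split; lra.
have e0 : 0 < e by rewrite /e; lra.
have pos : 0 < G (z + e) * G (w - e).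
  apply: same_sign; first by rewrite /e; lra.
  by move=> x /andP[? ?]; apply: nz; apply/andP; split; lra.
move: (G (z + e)) (G (w - e)) E1 E2 pos => g1 g2 E1 E2 pos.
have : g1 * g2 * (s z * s w) < 0.
  have -> : g1 * g2 * (s z * s w) = (g1 * s z) * (g2 * s w) by ring.
  rewrite E1 E2 addrAC subrr add0r [w - e - w]addrAC subrr add0r.
  have -> : c * e * (c' * - e) = - (c * e * (c' * e)) by ring.
  by rewrite oppr_lt0 !mulr_gt0.
by rewrite pmulr_rlt0.
Qed.

Lemma path_alternate (x : R) l : path (fun z w => s z * s w < 0) x l ->
  0 < (-1) ^+ size l * (s x * s (last x l)) \/ l = [::].
Proof.
elim: l x => [|y l IH] x /=; first by right.
move=> /andP[xy /IH [h|->]]; left; last by rewrite /= expr1 mulN1r oppr_gt0.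
rewrite exprS mulN1r.
have y2 : 0 < s y ^+ 2.
  by rewrite exprn_even_gt0//=; apply: contraTneq xy => ->; rewrite mulr0 ltxx.
suff : 0 < s y ^+ 2 * (- (-1) ^+ size l * (s x * s (last y l))).
  by rewrite pmulr_rgt0.
have -> : s y ^+ 2 * (- (-1) ^+ size l * (s x * s (last y l))) =
  - (s x * s y) * ((-1) ^+ size l * (s y * s (last y l))) by ring.
by rewrite mulr_gt0// oppr_gt0.
Qed.

(** The sign of s alternates along z = z_1 < ... < z_n < z + 1, and is the same at
    both ends of this list. *)
Lemma even_periodic_zeros (F : {fset R}) :
  (forall x, x \in F <-> 0 <= x < 1 /\ G x = 0) -> ~~ odd #|` F|%fset.
Proof.
move=> FP; pose l := sort <=%R (enum_fset F).
have lF x : (x \in l) = (x \in F) by rewrite mem_sort.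
have sl : size l = #|` F|%fset by rewrite size_sort.
have lsort : sorted <%R l.
  by rewrite lt_sorted_uniq_le sort_uniq fset_uniq sort_sorted//; exact: le_total.
rewrite -sl; case: l lF lsort {sl} => // z r lF srt.
have zF : z \in F by rewrite -lF mem_head.
have [/andP[z0 z1] Gz] := (FP z).1 zF.
pose L := rcons (z :: r) (z + 1).
have Lsort : sorted <%R L.
  rewrite /L /= rcons_path (srt : path _ _ _) /=.
  have : last z r \in F by rewrite -lF mem_last.
  by move=> /FP[/andP[_ h] _]; lra.
have szL : size L = (size r).+2 by rewrite /L size_rcons.
have Lz i : (i < size L)%N -> G (nth 0 L i) = 0.
  move=> iL; have : nth 0 L i \in L by rewrite mem_nth.
  rewrite /L mem_rcons in_cons => /orP[/eqP ->|]; first by rewrite pG.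
  by rewrite lF => /FP[].
have ltL i j : (i < size L)%N -> (j < size L)%N -> (nth 0 L i < nth 0 L j) = (i < j)%N.
  move=> iL jL; rewrite (lt_sorted_ltn_nth 0 Lsort)//.
have cons i : (i.+1 < size L)%N -> s (nth 0 L i) * s (nth 0 L i.+1) < 0.
  move=> iL; have iL' : (i < size L)%N by exact: ltnW.
  apply: consecutive_zeros; [by rewrite ltL|exact: Lz|exact: Lz|].
  move=> x /andP[ix xi]; apply/eqP => Gx.
  have inL y : 0 <= y < 1 -> G y = 0 -> exists2 j, (j < size L)%N & nth 0 L j = y.
    move=> y01 Gy; have yL : y \in L.
      by rewrite /L mem_rcons in_cons lF (FP y).2// orbT.
    by exists (index y L); [rewrite index_mem|rewrite nth_index].
  have zi : z <= nth 0 L i.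
    case: i ix xi iL iL' => [|i] ix xi iL iL'; first by rewrite /L.
    by rewrite ltW// -[X in X < _]/(nth 0 L 0) ltL.
  have iz : nth 0 L i.+1 <= z + 1.
    have -> : z + 1 = nth 0 L (size r).+1 by rewrite /L nth_rcons /= ltnn eqxx.
    have ir : (i.+1 <= (size r).+1)%N by rewrite -ltnS -szL.
    by rewrite leNgt ltL ?szL// ltnNge ir.
  have [x1|x1] := ltP x 1.
    have [|j jL E] := inL x _ Gx; first by apply/andP; split; lra.
    move: ix xi; rewrite -E !ltL// => ij; rewrite ltnS leqNgt.
    by rewrite ij.
  have Gx1 : G (x - 1) = 0 by rewrite -(pG (x - 1)) subrK.
  have [|j jL E] := inL (x - 1) _ Gx1; first by apply/andP; split; lra.
  have : nth 0 L j < nth 0 L 0 by rewrite E -[nth 0 L 0]/z; lra.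
  by rewrite ltL// szL.
have pth : path (fun z w => s z * s w < 0) z (rcons r (z + 1)).
  apply/(pathP 0) => i; rewrite size_rcons => ir.
  by have := cons i; rewrite szL /L /= => /(_ ir).
case: (path_alternate pth) => [|]; last by case: (r).
rewrite last_rcons size_rcons ps -expr2 -signr_odd /=.
by case: odd => //=; rewrite expr1 mulN1r oppr_gt0 ltNge sqr_ge0.
Qed.

End PeriodicZeros.
End Counting.

(** * The secant along a curve of parallel pairs *)

Section Branches.
Context {R : realType}.
Variable f : R -> R * R.
Hypothesis closed_f : closed_smooth_curve f.
Hypothesis generic_f : generic f.
Local Notation X := (fst \o f).
Local Notation Y := (snd \o f).
Local Notation X1 := (fx1 f).
Local Notation Y1 := (fy1 f).
Local Notation X2 := (fx2 f).
Local Notation Y2 := (fy2 f).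
Local Notation K := (wronskian f).
Local Notation K' := (wronskian' f).
Local Notation cross := (tangent_cross f).
Local Notation dot := (tangent_dot f).
Local Notation speed := (tangent_speed f).

Lemma Sigma_cross (p : R * R) : Sigma f p -> cross p.1 p.2 = 0.
Proof.
move=> Sp; apply/eqP; apply: contrapT => /negP c0.
have n : \forall q \near p, cross q.1 q.2 != 0.
  exact: (cvgr_neq0 (cross p.1 p.2) (@cross_cont _ _ closed_f p) c0).
have [q [[_ /= cq] /= /eqP]] := Sp _ n.
by rewrite -(crossE closed_f) cq.
Qed.

(** If K did not vanish there, it would have the same sign at the ends of all
    nearby pairs, against near_diagonal. *)
Lemma Sigma_diagonal (p : R * R) : Sigma f p -> ~ distinct_on_circle p.1 p.2 ->
  K p.1 = 0.
Proof.
move=> Sp ndp; apply/eqP; apply: contrapT => /negP K0.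
have KK : 0 < K p.1 * K p.2.
  have [m E] := distinctPn ndp.
  have Kp : K p.2 = K p.1 by rewrite -E; exact: esym (K_int closed_f m p.2).
  by rewrite Kp -expr2 exprn_even_gt0.
have cKK : {for p, continuous (fun q : R * R => K q.1 * K q.2)}.
  by apply: continuousM; [exact: (@Cinf_along_fst R _ p (smooth_K closed_f))|
                          exact: (@Cinf_along_snd R _ p (smooth_K closed_f))].
have n1 : \forall q \near p, 0 < K q.1 * K q.2.
  exact: (cvgr_gt (K p.1 * K p.2) cKK _ KK).
have n2 := near_diagonal_torus closed_f generic_f ndp.
have [q [[dq cq] [q1 q2]]] := Sp _ (filterI n1 n2).
rewrite (crossE closed_f) in cq; have [h _] := q2 dq cq.
by move: q1 => /=; rewrite ltNge (ltW h).
Qed.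

(** For a secant f a - f b whose ends have velocities mu * (x1, y1) and (x1, y1)
    and accelerations (u, v) and (x2, y2) in the parameter of f; the hypothesis is
    the derivative of the relation that these velocities are parallel. *)
Lemma det_along_branch (a1 b1 a2 b2 mu x1 y1 x2 y2 u v : R) :
  a1 * (x1 * v - y1 * u) = b1 * (mu * (x1 * y2 - y1 * x2)) ->
  let x1' := mu * x1 * a1 - x1 * b1 in
  let y1' := mu * y1 * a1 - y1 * b1 in
  let x2' := (u * a1 * a1 + mu * x1 * a2) - (x2 * b1 * b1 + x1 * b2) in
  let y2' := (v * a1 * a1 + mu * y1 * a2) - (y2 * b1 * b1 + y1 * b2) in
  x1' * y2' - y1' * x2' = (mu * a1 - b1) ^+ 2 * (b1 * (x1 * y2 - y1 * x2)).
Proof.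
move=> rel x1' y1' x2' y2'.
have -> : x1' * y2' - y1' * x2' = (mu * a1 - b1) *
   (a1 * (a1 * (x1 * v - y1 * u)) - b1 * b1 * (x1 * y2 - y1 * x2)).
  by rewrite /x1' /y1' /x2' /y2'; ring.
by rewrite rel; ring.
Qed.

Section ParallelCurve.
Variables (U : set R) (a b : R -> R).
Hypothesis oU : open U.
Hypothesis ca : Cinf U a.
Hypothesis cb : Cinf U b.
Hypothesis ab0 : forall x, U x -> cross (a x) (b x) = 0.

Let c x : R * R := f (a x) - f (b x).
(** The factor from f' (b x) to f' (a x). *)
Definition ratio (a b : R -> R) x : R := dot (a x) (b x) / dot (b x) (b x).
Local Notation mu := (ratio a b).
(** The velocity of the secant, in units of f' (b x). *)
Definition secant_speed (a b : R -> R) x : R :=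
  ratio a b x * derive1 a x - derive1 b x.
Local Notation la := (secant_speed a b).

Lemma smooth_compU F g : Cinf setT F -> Cinf U g -> Cinf U (fun x => F (g x)).
Proof. by move=> cF cg; exact: (Cinf_comp (fun x _ => Logic.I) cF cg). Qed.

Lemma secant_fst : fst \o c = fun x => X (a x) - X (b x).
Proof. by apply/funext => x. Qed.

Lemma secant_snd : snd \o c = fun x => Y (a x) - Y (b x).
Proof. by apply/funext => x. Qed.

Lemma secant_smooth : Cinf U (fst \o c) /\ Cinf U (snd \o c).
Proof.
rewrite secant_fst secant_snd; split; apply: CinfB; apply: smooth_compU => //.
- exact: smooth_X closed_f.
- exact: smooth_X closed_f.
- exact: smooth_Y closed_f.
- exact: smooth_Y closed_f.
Qed.

Lemma ratioE x : U x ->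
  X1 (a x) = mu x * X1 (b x) /\ Y1 (a x) = mu x * Y1 (b x).
Proof.
move=> Ux; have c0 := ab0 Ux; have d0 := lt0r_neq0 (dot_gt0 closed_f generic_f (b x)).
have mE (y z : R) : dot (b x) (b x) * y = dot (a x) (b x) * z -> y = mu x * z.
  by move=> /(eq_divl d0) ->; rewrite /ratio mulrAC.
split; apply: mE; apply/eqP; rewrite -subr_eq0; apply/eqP.
  by rewrite -[RHS](mul0r (Y1 (b x))) -c0 /tangent_dot /tangent_cross; ring.
by rewrite -[RHS](mul0r (- X1 (b x))) -c0 /tangent_dot /tangent_cross; ring.
Qed.

Lemma ratio_smooth : Cinf U mu.
Proof.
have a1 := smooth_compU (smooth_X1 closed_f) ca.
have a2 := smooth_compU (smooth_Y1 closed_f) ca.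
have b1 := smooth_compU (smooth_X1 closed_f) cb.
have b2 := smooth_compU (smooth_Y1 closed_f) cb.
apply: CinfM; first by apply: CinfD; exact: CinfM.
apply: Cinf_inv; last by apply: CinfD; exact: CinfM.
by move=> x _; rewrite gt_eqF//; exact: dot_gt0.
Qed.

Lemma secant_speed_smooth : Cinf U la.
Proof.
apply: CinfB; last exact: Cinf_derive1.
by apply: CinfM; [exact: ratio_smooth|exact: Cinf_derive1].
Qed.

Lemma is_derive_compU (F F' : R -> R) (g : R -> R) x :
  (forall t : R, is_derive t 1 F (F' t)) ->
  Cinf U g -> U x -> is_derive x 1 (fun y => F (g y)) (F' (g x) * derive1 g x).
Proof. by move=> dF cg Ux; exact: is_der_comp (dF _) (Cinf_is_derive cg Ux). Qed.

Lemma parallel_relation x : U x ->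
  derive1 a x * (X1 (b x) * Y2 (a x) - Y1 (b x) * X2 (a x)) =
  derive1 b x * (mu x * K (b x)).
Proof.
move=> Ux; have [eX eY] := ratioE Ux.
have dcr := is_derB
  (is_derM (is_derive_compU (is_derive_X1 closed_f) ca Ux)
           (is_derive_compU (is_derive_Y1 closed_f) cb Ux))
  (is_derM (is_derive_compU (is_derive_Y1 closed_f) ca Ux)
           (is_derive_compU (is_derive_X1 closed_f) cb Ux)).
have z := @is_derive_eq_on R U _ (cst 0) x _ oU Ux ab0 dcr.
have [_ E0] := is_derive_cst (0 : R) x (1 : R).
have [_ E2] := z; have E1 := etrans (esym E0) E2; rewrite eX eY in E1.
rewrite /wronskian; move: (derive1 a x) (derive1 b x) (ratio a b x) E1.
move: (X1 (b x)) (Y1 (b x)) (X2 (a x)) (Y2 (a x)) (X2 (b x)) (Y2 (b x)).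
move=> x1 y1 u v x2 y2 a1 b1 m E1.
by apply/eqP; rewrite -subr_eq0; apply/eqP; rewrite -[RHS]oppr0 [X in _ = - X]E1; ring.
Qed.

Lemma parallel_relation_sym x : U x ->
  derive1 a x * K (a x) = derive1 b x * (mu x ^+ 2 * K (b x)).
Proof.
move=> Ux; have := parallel_relation Ux; have [eX eY] := ratioE Ux.
rewrite -!wronskianE eX eY; move: (mu x) (derive1 a x) (derive1 b x).
move: (X1 (b x)) (Y1 (b x)) (X2 (a x)) (Y2 (a x)) (X2 (b x)) (Y2 (b x)).
move=> x1 y1 u v x2 y2 m a1 b1 h; transitivity (m * (a1 * (x1 * v - y1 * u))).
  by ring.
by rewrite h; ring.
Qed.

Lemma is_derive_secant_fst x : U x -> is_derive x 1 (fst \o c)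
  (X1 (a x) * derive1 a x - X1 (b x) * derive1 b x).
Proof.
move=> Ux; rewrite secant_fst.
exact: is_derB (is_derive_compU (is_derive_X closed_f) ca Ux)
  (is_derive_compU (is_derive_X closed_f) cb Ux).
Qed.

Lemma is_derive_secant_snd x : U x -> is_derive x 1 (snd \o c)
  (Y1 (a x) * derive1 a x - Y1 (b x) * derive1 b x).
Proof.
move=> Ux; rewrite secant_snd.
exact: is_derB (is_derive_compU (is_derive_Y closed_f) ca Ux)
  (is_derive_compU (is_derive_Y closed_f) cb Ux).
Qed.

Lemma derive1_secant x : U x ->
  derive1 c x = (la x * X1 (b x), la x * Y1 (b x)).
Proof.
move=> Ux; have [c1 c2] := secant_smooth; have [eX eY] := ratioE Ux.
rewrite (derive1_pair oU c1 c2 Ux) (derive1_val (is_derive_secant_fst Ux)).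
rewrite (derive1_val (is_derive_secant_snd Ux)) eX eY /secant_speed.
move: (derive1 a x) (derive1 b x) (ratio a b x) (X1 (b x)) (Y1 (b x)).
by move=> a1 b1 m x1 y1; congr (_, _); ring.
Qed.

(** The branch has the direction of f' at both ends of the chord, so it turns
    with the tangent line of f. *)
Lemma curvature_secant x : U x -> la x != 0 ->
  exists2 C, 0 < C & curvature c x = C * (derive1 b x * K (b x)).
Proof.
move=> Ux la0; have [c1 c2] := secant_smooth; have [eX eY] := ratioE Ux.
have ca' := Cinf_derive1 oU ca; have cb' := Cinf_derive1 oU cb.
have sec (F F1 F2 : R -> R) : (forall t : R, is_derive t 1 F (F1 t)) ->
    (forall t : R, is_derive t 1 F1 (F2 t)) ->
    (fun y => F (a y) - F (b y))^`(2) x =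
    (F2 (a x) * derive1 a x * derive1 a x + F1 (a x) * derive1 (derive1 a) x) -
    (F2 (b x) * derive1 b x * derive1 b x + F1 (b x) * derive1 (derive1 b) x).
  move=> dF dF1; rewrite derive1nS derive1n1.
  have e1 y : U y -> derive1 (fun y => F (a y) - F (b y)) y =
      F1 (a y) * derive1 a y - F1 (b y) * derive1 b y.
    move=> Uy; apply: derive1_val.
    exact: is_derB (is_derive_compU dF ca Uy) (is_derive_compU dF cb Uy).
  rewrite (derive1_eq_on oU Ux e1); apply: derive1_val.
  exact: is_derB
    (is_derM (is_derive_compU dF1 ca Ux) (Cinf_is_derive ca' Ux))
    (is_derM (is_derive_compU dF1 cb Ux) (Cinf_is_derive cb' Ux)).
have E1 : c^`() x = (mu x * X1 (b x) * derive1 a x - X1 (b x) * derive1 b x,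
                     mu x * Y1 (b x) * derive1 a x - Y1 (b x) * derive1 b x).
  rewrite (derive1_pair oU c1 c2 Ux) (derive1_val (is_derive_secant_fst Ux)).
  by rewrite (derive1_val (is_derive_secant_snd Ux)) eX eY.
have E2 := derive1n_plane 2 oU c1 c2 Ux.
rewrite secant_fst secant_snd in E2.
rewrite (sec _ _ _ (is_derive_X closed_f) (is_derive_X1 closed_f)) in E2.
rewrite (sec _ _ _ (is_derive_Y closed_f) (is_derive_Y1 closed_f)) eX eY in E2.
rewrite (curvature_plane oU c1 c2 Ux E1 E2).
rewrite (det_along_branch _ _ (parallel_relation Ux)).
set s := Num.sqrt _; have s0 : 0 < s.
  rewrite sqrtr_gt0.
  have -> : mu x * X1 (b x) * derive1 a x - X1 (b x) * derive1 b x = la x * X1 (b x).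
    rewrite /secant_speed; move: (derive1 a x) (derive1 b x) (ratio a b x).
    by move: (X1 (b x)) => z1 a1 b1 m; ring.
  have -> : mu x * Y1 (b x) * derive1 a x - Y1 (b x) * derive1 b x = la x * Y1 (b x).
    rewrite /secant_speed; move: (derive1 a x) (derive1 b x) (ratio a b x).
    by move: (Y1 (b x)) => z1 a1 b1 m; ring.
  rewrite !exprMn -mulrDr mulr_gt0 ?exprn_even_gt0//.
  by have := dot_gt0 closed_f generic_f (b x); rewrite /tangent_dot !expr2.
exists (la x ^+ 2 / s ^+ 3).
  by rewrite mulr_gt0 ?exprn_even_gt0// invr_gt0 exprn_gt0.
by rewrite -/(la x) mulrAC.
Qed.

End ParallelCurve.
End Branches.

(** * Cusps and inflexions of a branch *)

Section BranchPoints.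
Context {R : realType}.
Variable f : R -> R * R.
Hypothesis closed_f : closed_smooth_curve f.
Hypothesis generic_f : generic f.
Local Notation K := (wronskian f).
Local Notation cross := (tangent_cross f).
Local Notation dot := (tangent_dot f).

Lemma branch_data (p : R * R) (gamma : R -> R * R) :
  local_parameterization f p gamma ->
  exists2 e, 0 < e & let U := oball 0 e in
  [/\ Cinf U (fst \o gamma), Cinf U (snd \o gamma),
      forall x, U x -> Sigma f (gamma x), gamma 0 = p &
      derive1 (fst \o gamma) 0 != 0 \/ derive1 (snd \o gamma) 0 != 0].
Proof.
move=> [g0 [e e0 [sg rg _ [V oV VE]]]]; exists e => //.
have UE : oball 0 e = [set x : R | - e < x < e].
  by apply/seteqP; split=> x; rewrite /oball /= sub0r add0r.
have U0 : oball 0 e 0 by exact: oball_center.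
rewrite -UE in sg VE rg.
have [c1 c2] := (smooth_on_plane gamma (@open_oball R 0 e)).1 sg.
split => //.
  move=> x Ux; have : (gamma @` oball 0 e) (gamma x) by exists x.
  by rewrite -VE => -[/connected_component_sub].
have := rg 0 U0.
rewrite (derive1_pair (@open_oball R 0 e) c1 c2 U0) => h.
have [E1|] := eqVneq (derive1 (fst \o gamma) 0) 0; last by left.
have [E2|] := eqVneq (derive1 (snd \o gamma) 0) 0; last by right.
by move: h; rewrite E1 E2 eqxx.
Qed.

Lemma secant_compE (gamma : R -> R * R) : secant f \o gamma =
  fun x => f ((fst \o gamma) x) - f ((snd \o gamma) x).
Proof. by []. Qed.

(** The inflexion stays between the two ends, so the product of their displacements
    is nonpositive, and hence so is the product of their speeds. *)
Lemma diagonal_speeds (p : R * R) gamma : Sigma f p -> p.1 = p.2 ->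
  local_parameterization f p gamma ->
  derive1 (fst \o gamma) 0 != derive1 (snd \o gamma) 0.
Proof.
move=> Sp pd lp; have [e e0 [ca cb Sg g0 nz]] := branch_data lp.
have U0 := oball_center 0 e0.
set a := fst \o gamma in ca nz *; set b := snd \o gamma in cb nz *.
have ndp (s : R) : ~ distinct_on_circle s s.
  by rewrite /distinct_on_circle subrr; apply/negP; rewrite negbK int_num0.
have K0 : K p.1 = 0 by apply: (Sigma_diagonal closed_f generic_f Sp); rewrite pd.
have [d1 d10 P1] := near_diagonal closed_f generic_f p.1.
have [d2 d20 P2] := K_isolated closed_f generic_f p.1.
have /is_derive1_caratheodory [A [AE cA A0]] := Cinf_is_derive ca U0.
have /is_derive1_caratheodory [B [BE cB B0]] := Cinf_is_derive cb U0.
have a0 : a 0 = p.1 by rewrite /a /= g0.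
have b0 : b 0 = p.1 by rewrite /b /= g0.
apply/eqP => E; rewrite -/a -/b in A0 B0 nz E.
have pos : 0 < A 0 * B 0.
  by rewrite A0 B0 -E -expr2 exprn_even_gt0//; case: nz; rewrite ?E.
have cAB : {for 0, continuous (fun x => A x * B x)} by exact: continuousM.
have n1 : \forall x \near 0, 0 < A x * B x by exact: (cvgr_gt (A 0 * B 0) cAB _ pos).
have na (P : set R) (g : R -> R) : Cinf (oball 0 e) g -> nbhs (g 0) P ->
    \forall x \near 0, P (g x).
  by move=> cg; exact: (Cinf_continuous cg U0).
pose B12 := [set s | oball p.1 d1 s /\ oball p.1 d2 s].
have nB : nbhs p.1 B12 by apply: filterI; exact: oball_nbhs.
have n2 : \forall x \near 0, B12 (a x) by apply: na => //; rewrite a0.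
have n3 : \forall x \near 0, B12 (b x) by apply: na => //; rewrite b0.
have n4 := oball_nbhs 0 e0.
have [d d0 Pd] := nbhs_oball (filterI (filterI n1 n4) (filterI n2 n3)).
have Bd : oball 0 d (d / 2) by apply/andP; split; lra.
have [[AB Ux] [[a1 a2] [b1 b2]]] := Pd _ Bd.
move: (d / 2) (divr_gt0 d0 (ltr0Sn R 1)) AB Ux a1 a2 b1 b2 => x x0 AB Ux a1 a2 b1 b2.
have le0 : (a x - p.1) * (b x - p.1) <= 0.
  have Sx := Sg x Ux.
  have [ab|ab] := eqVneq (a x) (b x).
    have Ka : K (a x) = 0.
      have gx : (gamma x).1 = (gamma x).2 := ab.
      by apply: (Sigma_diagonal closed_f generic_f Sx); rewrite gx.
    by rewrite (P2 _ a2 Ka) subrr mul0r.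
  by have [_ /ltW] := P1 _ _ a1 b1 ab (Sigma_cross closed_f Sx).
move: le0; rewrite -a0 AE.
have -> : b x - a 0 = B x * (x - 0) by rewrite a0 -b0 BE.
rewrite !subr0 => le0.
have : 0 < A x * x * (B x * x).
  have -> : A x * x * (B x * x) = (A x * B x) * x ^+ 2 by ring.
  by rewrite mulr_gt0// exprn_gt0.
by rewrite ltNge le0.
Qed.

Section AtBranch.
Variables (p : R * R) (gamma : R -> R * R) (e : R).
Hypothesis e0 : 0 < e.
Let U := oball 0 e.
Let a := fst \o gamma.
Let b := snd \o gamma.
Hypothesis ca : Cinf U a.
Hypothesis cb : Cinf U b.
Hypothesis Sg : forall x, U x -> Sigma f (gamma x).
Hypothesis g0 : gamma 0 = p.
Let oU : open U. Proof. exact: open_oball. Qed.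
Let U0 : U 0. Proof. exact: oball_center. Qed.
Let ab0 x : U x -> cross (a x) (b x) = 0.
Proof. by move=> Ux; exact: (Sigma_cross closed_f (Sg Ux)). Qed.
Local Notation la := (secant_speed f a b).
Local Notation mu := (ratio f a b).

(** A regular curve has f' (b 0) <> 0, so only the factor in front of it can vanish. *)
Lemma secant_stationaryP : derive1 (secant f \o gamma) 0 = 0 <-> la 0 = 0.
Proof.
have E := derive1_secant closed_f generic_f oU ca cb ab0 U0.
rewrite -secant_compE in E; rewrite E; split=> [[h1 h2]|->]; last by rewrite !mul0r.
have r := generic_regular generic_f (b 0); rewrite velocityE// in r.
apply/eqP; apply: contraNT r => l0.
move: h1 h2 => /eqP; rewrite mulf_eq0 (negbTE l0) /= => /eqP -> /eqP.
by rewrite mulf_eq0 (negbTE l0) /= => /eqP ->.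
Qed.

(** If the secant stops then b' = mu a', and the derivative of the parallelism of
    the tangents becomes K (a 0) = mu^3 K (b 0). *)
Lemma singular_branch : derive1 a 0 != 0 \/ derive1 b 0 != 0 ->
  la 0 = 0 -> equal_curvatures f p.1 p.2.
Proof.
move=> nz la0; have rel := parallel_relation_sym closed_f generic_f oU ca cb ab0 U0.
have bE : derive1 b 0 = mu 0 * derive1 a 0 by apply/esym/subr0_eq.
have a'0 : derive1 a 0 != 0.
  by case: nz => //; rewrite bE; apply: contra => /eqP ->; rewrite mulr0.
have a0E : a 0 = p.1 by rewrite /a /= g0.
have b0E : b 0 = p.2 by rewrite /b /= g0.
have tt := lt0r_neq0 (dot_gt0 closed_f generic_f p.2).
move: rel; rewrite bE /ratio a0E b0E /equal_curvatures.
move: (derive1 a 0) a'0 (dot p.2 p.2) tt (dot p.1 p.2) (K p.1) (K p.2).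
move=> a1 a10 d22 d220 d12 k1 k2 h.
have -> : k1 = d12 ^+ 3 / d22 ^+ 3 * k2.
  apply: (mulfI a10); rewrite h; field; exact: d220.
by field; exact: d220.
Qed.

(** The curvature of the branch has the sign of b' K(b).  By the relation between
    a' K(a) and b' K(b) this is nonzero at 0 if K vanishes at neither end, and then
    the sign does not change. *)
Lemma inflexion_branch : derive1 (secant f \o gamma) 0 != 0 ->
  (derive1 a 0 != 0 \/ derive1 b 0 != 0) ->
  inflexion (secant f \o gamma) 0 -> K p.1 * K p.2 = 0.
Proof.
move=> c0 nz infl; apply/eqP; apply: contrapT => /negP; rewrite mulf_eq0 negb_or.
move=> /andP[K1 K2].
have l0 : la 0 != 0 by apply: contraNneq c0 => /secant_stationaryP ->.
have rel := parallel_relation_sym closed_f generic_f oU ca cb ab0 U0.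
have a0E : a 0 = p.1 by rewrite /a /= g0.
have b0E : b 0 = p.2 by rewrite /b /= g0.
have b'0 : derive1 b 0 != 0.
  case: nz => // a'0; apply/eqP => b'0; move: rel; rewrite b'0 mul0r a0E => /eqP.
  by rewrite mulf_eq0 (negbTE a'0) (negbTE K1).
pose W x := derive1 b x * K (b x).
have cla : {for 0, continuous la}.
  exact: Cinf_continuous (secant_speed_smooth closed_f generic_f oU ca cb) U0.
have cW : Cinf U W.
  by apply: CinfM; [exact: Cinf_derive1|exact: smooth_compU (smooth_K closed_f) cb].
have cW0 : {for 0, continuous W} by exact: Cinf_continuous cW U0.
have W0 : W 0 != 0 by rewrite /W b0E mulf_neq0.
have nla : \forall x \near 0, la x != 0 by exact: (cvgr_neq0 (la 0) cla l0).
have nU := oball_nbhs 0 e0.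
have curvE x : U x -> la x != 0 ->
    exists2 C, 0 < C & curvature (secant f \o gamma) x = C * W x.
  by move=> Ux lx; exact: (curvature_secant closed_f generic_f oU ca cb ab0 Ux lx).
have sides (P : R -> Prop) : (\forall x \near 0, P x) ->
    (\forall x \near 0^'-, P x) /\ (\forall x \near 0^'+, P x).
  by move=> nP; split; apply: cvg_within; exact: nP.
have contra (Q1 Q2 : R -> Prop) (F : set_system R) : ProperFilter F ->
    (\forall x \near F, Q1 x) -> (\forall x \near F, Q2 x) ->
    (forall x, Q1 x -> Q2 x -> False) -> False.
  move=> FF h1 h2 h; have [x [q1 q2]] := filter_ex (filterI h1 h2); exact: h q1 q2.
have [Wp|Wn] : 0 < W 0 \/ W 0 < 0.
  by case: (ltgtP (W 0) 0) W0 => // h _; [right|left].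
  have n : \forall x \near 0, 0 < curvature (secant f \o gamma) x.
    have nW : \forall x \near 0, 0 < W x by exact: (cvgr_gt (W 0) cW0 _ Wp).
    apply: filterS (filterI nU (filterI nla nW)) => x [Ux [lx Wx]].
    by have [C C0 ->] := curvE x Ux lx; rewrite mulr_gt0.
  have [nl nr] := sides _ n; case: infl => -[il ir].
    by apply: contra nl il _ => x h h'; have := lt_trans h h'; rewrite ltxx.
  by apply: contra nr ir _ => x h h'; have := lt_trans h h'; rewrite ltxx.
have n : \forall x \near 0, curvature (secant f \o gamma) x < 0.
  have nW : \forall x \near 0, W x < 0 by exact: (cvgr_lt (W 0) cW0 _ Wn).
  apply: filterS (filterI nU (filterI nla nW)) => x [Ux [lx Wx]].
  by have [C C0 ->] := curvE x Ux lx; rewrite pmulr_rlt0.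
have [nl nr] := sides _ n; case: infl => -[il ir].
  by apply: contra nr ir _ => x h h'; have := lt_trans h h'; rewrite ltxx.
by apply: contra nl il _ => x h h'; have := lt_trans h h'; rewrite ltxx.
Qed.

End AtBranch.

Lemma cusp_singular (p : R * R) : distinct_on_circle p.1 p.2 ->
  branch_cusp f p -> singular_pairs f p.
Proof.
move=> dp [Sp [gamma lp [c0 _]]].
have [e e0 [ca cb Sg g0 nz]] := branch_data lp.
split=> //; first exact: (Sigma_cross closed_f Sp).
exact: (singular_branch e0 ca cb Sg g0 nz ((secant_stationaryP e0 ca cb Sg).1 c0)).
Qed.

Lemma inflexion_pair_of_branch (p : R * R) : distinct_on_circle p.1 p.2 ->
  branch_inflexion f p -> inflexion_pairs f p.
Proof.
move=> dp [Sp [gamma lp [c0 ic]]].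
have [e e0 [ca cb Sg g0 nz]] := branch_data lp.
split=> //; first exact: (Sigma_cross closed_f Sp).
exact: (inflexion_branch e0 ca cb Sg g0 c0 nz ic).
Qed.

Lemma diagonal_not_cusp (p : R * R) : p.1 = p.2 -> ~ branch_cusp f p.
Proof.
move=> pd [Sp [gamma lp [c0 _]]].
have [e e0 [ca cb Sg g0 nz]] := branch_data lp.
have := (secant_stationaryP e0 ca cb Sg).1 c0; rewrite /secant_speed /ratio.
have -> : (fst \o gamma) 0 = p.1 by rewrite /= g0.
have -> : (snd \o gamma) 0 = p.1 by rewrite /= g0 pd.
rewrite divff; last exact: lt0r_neq0 (dot_gt0 closed_f generic_f p.1).
rewrite mul1r => /subr0_eq E; have := diagonal_speeds Sp pd lp.
by rewrite E eqxx.
Qed.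

End BranchPoints.

(** * Exchanging the ends of a chord *)

Section Swap.
Context {R : realType}.
Variable f : R -> R * R.
Hypothesis closed_f : closed_smooth_curve f.
Hypothesis generic_f : generic f.
Local Notation cross := (tangent_cross f).

Lemma swap_continuous : continuous (@swap R).
Proof.
move=> p; have c1 := @continuous_fst R R R p; have c2 := @continuous_snd R R R p.
exact: (cvg_pair (F := nbhs p) (G := nbhs p.2) (H := nbhs p.1) c2 c1).
Qed.

Lemma distinct_sym (s t : R) : distinct_on_circle s t -> distinct_on_circle t s.
Proof. by rewrite /distinct_on_circle -opprB rpredN. Qed.

Lemma Sigma_swap (p : R * R) : Sigma f p -> Sigma f (swap p).
Proof.
move=> Sp B nB; have [q [[dq cq] Bq]] := Sp _ (swap_continuous nB).
exists (swap q); split; last exact: Bq.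
split; first exact: distinct_sym dq.
have det2C (u v : R * R) : det2 u v = 0 -> det2 v u = 0.
  by case: u v => [u1 u2] [v1 v2]; rewrite /det2 /=; lra.
exact: det2C cq.
Qed.

Lemma component_swap (p : R * R) : Sigma f p ->
  connected_component (Sigma f) (swap p) = @swap R @` connected_component (Sigma f) p.
Proof.
have sub q : Sigma f q -> @swap R @` connected_component (Sigma f) q `<=`
    connected_component (Sigma f) (swap q).
  move=> Sq; apply: connected_component_max.
  - by exists q => //; exact: connected_component_refl.
  - by move=> _ [r /connected_component_sub Sr <-]; exact: Sigma_swap.
  - apply: connected_continuous_connected; first exact: component_connected.
    by apply: continuous_subspaceT; exact: swap_continuous.
move=> Sp; apply/seteqP; split; last exact: sub.
move=> q cq; exists (swap q); last by rewrite swapK.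
have := sub _ (Sigma_swap Sp); rewrite swapK; apply.
by exists q.
Qed.

Lemma local_parameterization_swap (p : R * R) gamma : Sigma f p ->
  local_parameterization f p gamma ->
  local_parameterization f (swap p) (@swap R \o gamma).
Proof.
move=> Sp [g0 [e e0 [sg rg ig [V oV VE]]]].
split; first by rewrite /= g0.
have UE : [set x : R | - e < x < e] = oball 0 e.
  by apply/seteqP; split=> x; rewrite /oball /= sub0r add0r.
exists e; first exact: e0.
cbv zeta; rewrite UE in sg rg ig VE *.
have oJ := @open_oball R 0 e.
have [c1 c2] := (smooth_on_plane gamma oJ).1 sg; split.
- by apply/(smooth_on_plane _ oJ); split; [exact: c2|exact: c1].
- move=> x Jx; have := rg x Jx; rewrite (derive1_pair oJ c1 c2 Jx).
  rewrite (@derive1_pair _ _ (@swap R \o gamma) _ oJ c2 c1 Jx).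
  by rewrite !xpair_eqE andbC.
- by move=> x y Jx Jy /= /(inv_inj (@swapK R)); exact: ig.
- exists (@swap R @^-1` V).
    by apply: open_comp => // q _; exact: swap_continuous.
  rewrite component_swap// -[RHS]image_comp -VE.
  apply/seteqP; split.
    by move=> _ [[q cq <-] Vq]; exists q => //; split => //; rewrite /= swapK in Vq.
  by move=> _ [q [cq Vq] <-]; split; [exists q|rewrite /= swapK].
Qed.

Lemma secant_swap (gamma : R -> R * R) :
  secant f \o (@swap R \o gamma) = fun x => - (secant f \o gamma) x.
Proof. by apply/funext => x; rewrite /= /secant /= opprB. Qed.

Lemma derive1n_opp (U : set R) n (F : R -> R) x : open U -> Cinf U F -> U x ->
  derive1n n (fun y => - F y) x = - derive1n n F x.
Proof.
move=> oU cF; elim: n x => // n IH x Ux; rewrite !derive1nS.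
rewrite (derive1_eq_on oU Ux IH).
have dF := Cinf_is_derive (Cinf_derive1n n oU cF) Ux.
by apply: derive1_val; exact: is_deriveN.
Qed.

Lemma opp_curve (U : set R) (c : R -> R * R) : open U ->
  Cinf U (fst \o c) -> Cinf U (snd \o c) -> forall x, U x ->
  [/\ derive1 (fun y => - c y) x = - derive1 c x &
      curvature (fun y => - c y) x = curvature c x].
Proof.
move=> oU c1 c2 x Ux.
have c1' : Cinf U (fst \o (fun y => - c y)) by exact: CinfN.
have c2' : Cinf U (snd \o (fun y => - c y)) by exact: CinfN.
have E n : derive1n n (fun y => - c y) x = - derive1n n c x.
  rewrite (derive1n_plane n oU c1' c2' Ux) (derive1n_plane n oU c1 c2 Ux).
  by congr (_, _); exact: derive1n_opp oU _ Ux.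
have E1 : derive1 (fun y => - c y) x = - derive1 c x := E 1%N.
split; first exact: E1.
have E2 := E 2%N; rewrite /curvature.
move: (derive1n 2 (fun y => - c y) x) (derive1 (fun y => - c y) x) E1 E2.
move=> u v -> ->; move: (derive1 c x) (derive1n 2 c x) => [v1 v2] [u1 u2].
by rewrite /det2 /enorm /= !sqrrN !mulrNN.
Qed.

Lemma local_diffeo_opp (a : R * R) (Phi : R * R -> R * R) :
  local_diffeo a Phi -> local_diffeo (- a) (Phi \o -%R).
Proof.
move=> [U [G [oU Ua sP oP [sG GK]]]].
have im : (Phi \o -%R) @` [set x | U (- x)] = Phi @` U.
  apply/seteqP; split=> [_ [x /= Ux <-]|_ [x Ux <-]]; first by exists (- x).
  by exists (- x) => /=; rewrite opprK.
have co : continuous (-%R : R * R -> R * R) by exact: opp_continuous.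
exists [set x | U (- x)], (-%R \o G); rewrite im; split => //.
- by apply: (@open_comp _ _ -%R) => // x _; exact: co.
- by rewrite /= opprK.
- exact: smooth_on_compN.
- split; first exact: smooth_on_linear.
  by move=> x /= Ux; rewrite GK// opprK.
Qed.

Lemma branch_smooth (p : R * R) gamma : local_parameterization f p gamma ->
  exists2 e, 0 < e & Cinf (oball 0 e) (fst \o (secant f \o gamma)) /\
    Cinf (oball 0 e) (snd \o (secant f \o gamma)).
Proof.
move=> /branch_data [e e0 [ca cb Sg g0 nz]]; exists e => //.
exact: (secant_smooth closed_f (U := oball 0 e) ca cb).
Qed.

Lemma branch_cusp_swap (p : R * R) : branch_cusp f p -> branch_cusp f (swap p).
Proof.
move=> [Sp [gamma lp [c0 [h [Phi [dh h0 dP HP]]]]]].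
split; first exact: Sigma_swap.
exists (@swap R \o gamma); first exact: local_parameterization_swap.
have [e e0 [s1 s2]] := branch_smooth lp.
have oU := @open_oball R 0 e; have U0 := oball_center 0 e0.
rewrite secant_swap; split.
  by have [-> _] := opp_curve oU s1 s2 U0; rewrite c0 oppr0.
exists h, (Phi \o -%R); split => //; first exact: local_diffeo_opp.
by apply: filterS HP => x; rewrite /= opprK.
Qed.

Lemma branch_inflexion_swap (p : R * R) :
  branch_inflexion f p -> branch_inflexion f (swap p).
Proof.
move=> [Sp [gamma lp [c0 ic]]].
split; first exact: Sigma_swap.
exists (@swap R \o gamma); first exact: local_parameterization_swap.
have [e e0 [s1 s2]] := branch_smooth lp.
have oU := @open_oball R 0 e; have U0 := oball_center 0 e0.
rewrite secant_swap; split.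
  by have [-> _] := opp_curve oU s1 s2 U0; rewrite oppr_eq0.
have nU := oball_nbhs 0 e0.
have nl : \forall x \near 0^'-, oball 0 e x by apply: cvg_within; exact: nU.
have nr : \forall x \near 0^'+, oball 0 e x by apply: cvg_within; exact: nU.
have kE x : oball 0 e x ->
   curvature (fun y => - (secant f \o gamma) y) x = curvature (secant f \o gamma) x.
  by move=> Ux; have [] := opp_curve oU s1 s2 Ux.
case: ic => -[il ir]; [left|right]; split.
- by apply: filterS (filterI nl il) => x [Ux kx]; rewrite kE.
- by apply: filterS (filterI nr ir) => x [Ux kx]; rewrite kE.
- by apply: filterS (filterI nl il) => x [Ux kx]; rewrite kE.
- by apply: filterS (filterI nr ir) => x [Ux kx]; rewrite kE.
Qed.

End Swap.

(** * The fold of the tangent direction at an inflexion *)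

Section DiagonalBranch.
Context {R : realType}.
Variable f : R -> R * R.
Hypothesis closed_f : closed_smooth_curve f.
Hypothesis generic_f : generic f.
Local Notation K := (wronskian f).
Local Notation K' := (wronskian' f).
Local Notation cross := (tangent_cross f).
Local Notation dot := (tangent_dot f).
Local Notation X1 := (fx1 f).
Local Notation Y1 := (fy1 f).
Local Notation slope s0 t := (cross s0 t / dot s0 t).

Lemma cross_self s : cross s s = 0.
Proof. by rewrite /tangent_cross mulrC subrr. Qed.

(** N is the derivative of M, and m its second derivative at the double zero. *)
Lemma double_zero (U : set R) (M N q : R -> R) (m : R) : open U -> U 0 ->
  Cinf U q -> (forall y, U y -> M y = y * (y * q y)) ->
  (forall y, U y -> is_derive y 1 M (N y)) -> is_derive (0 : R) 1 N m ->
  m = 2 * q 0.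
Proof.
move=> oU U0 cq Mq dM dN.
have dq y : U y -> is_derive y 1 q (derive1 q y) by exact: Cinf_is_derive.
have NE y : U y -> N y = y * q y + y * (q y + y * derive1 q y).
  move=> Uy; have d1 := is_derM (is_derive_id y (1 : R)) (dq y Uy).
  have d2 := is_derM (is_derive_id y (1 : R)) d1.
  have d3 := @is_derive_eq_on R U _ M y _ oU Uy (fun z Uz => esym (Mq z Uz)) d2.
  have [_ E1] := d3; have [_ E2] := dM y Uy; rewrite E1 in E2.
  by rewrite -E2 !mul1r.
have cq' := Cinf_derive1 oU cq.
have dq' := Cinf_is_derive cq' U0.
have id0 := is_derive_id (0 : R) (1 : R).
have d1 := is_derM id0 (dq 0 U0).
have d2 := is_derM id0 (is_derD (dq 0 U0) (is_derM id0 dq')).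
have d3 := @is_derive_eq_on R U _ N 0 _ oU U0 (fun z Uz => esym (NE z Uz)) (is_derD d1 d2).
have [_ E1] := d3; have [_ E2] := dN; rewrite E1 in E2; rewrite -E2.
by move: (derive1 q 0) (derive1 (derive1 q) 0) => u v; ring.
Qed.

(** Near an inflexion the slope of the tangent line is, up to sign, the square
    of a coordinate: its derivative K has a simple zero (Morse lemma). *)
Lemma fold_coordinate s0 r : K s0 = 0 -> 0 < r ->
  exists h eps d, [/\ [/\ 0 < d, d <= r & eps != 0],
    Cinf (oball 0 d) h, 0 < derive1 h 0 & forall y, oball 0 d y ->
    [/\ 0 < dot s0 (s0 + y), (exists2 w, 0 < w & h y = y * w) &
        h y ^+ 2 = eps * slope s0 (s0 + y)]].
Proof.
move=> K0 r0; have [d1 d10 dpos] := dot_pos_near closed_f generic_f s0.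
have shift y : oball 0 d1 y -> oball s0 d1 (s0 + y).
  by move=> /oballP; rewrite subr0 => h; apply/oballP; rewrite addrAC subrr add0r.
pose V := oball (0 : R) d1; have oV : open V := @open_oball R 0 d1.
have V0 : V 0 := oball_center 0 d10.
have dp y : V y -> 0 < dot s0 (s0 + y) by move=> /shift /dpos.
have csh F : Cinf setT F -> Cinf V (fun y => F (s0 + y)).
  by move=> cF; apply: smooth_compU => //; apply: CinfD; [exact: Cinf_cst|exact: Cinf_id].
have ccr : Cinf setT (cross s0).
  by apply: CinfB; apply: CinfM; try exact: Cinf_cst; [exact: smooth_Y1|exact: smooth_X1].
have cdt : Cinf setT (dot s0).
  by apply: CinfD; apply: CinfM; try exact: Cinf_cst; [exact: smooth_X1|exact: smooth_Y1].
pose M y := slope s0 (s0 + y).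
have cM : Cinf V M.
  apply: CinfM; first exact: csh.
  by apply: Cinf_inv; [move=> y /dp /gt_eqF ->|exact: csh].
have M0 : M 0 = 0 by rewrite /M addr0 cross_self mul0r.
pose N y := dot s0 s0 * K (s0 + y) / dot s0 (s0 + y) ^+ 2.
have dsh (y : R) : is_derive y 1 (fun y : R => s0 + y) 1.
  by apply: (is_derive_ext (is_derD (is_derive_cst s0 y (1 : R)) (is_derive_id y (1 : R))));
    rewrite add0r.
have dM y : V y -> is_derive y 1 M (N y).
  move=> Vy; have q0 := lt0r_neq0 (dp y Vy).
  apply: (is_derive_ext (is_der_comp (is_derive_slope closed_f q0) (dsh y))).
  by rewrite mulr1.
have dot0 := lt0r_neq0 (dot_gt0 closed_f generic_f s0).
have dN : is_derive (0 : R) 1 N (K' s0 / dot s0 s0).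
  have dK0 := is_derive_K closed_f (s0 + 0); have dd0 := is_derive_dot closed_f s0 (s0 + 0).
  have e1 := is_derZ (dot s0 s0) (is_der_comp dK0 (dsh 0)).
  have e2 := is_der_comp dd0 (dsh 0).
  have q0 : dot s0 (s0 + 0) * dot s0 (s0 + 0) != 0 by rewrite addr0 mulf_neq0.
  have e3 := is_derM e1 (@is_derV R (fun y => dot s0 (s0 + y) * dot s0 (s0 + y))
    0 _ q0 (is_derM e2 e2)).
  have -> : N = fun y => dot s0 s0 * K (s0 + y) * (dot s0 (s0 + y) * dot s0 (s0 + y))^-1.
    by apply/funext => y; rewrite /N expr2.
  apply: (is_derive_ext e3); rewrite addr0 K0 mulr0 mul0r addr0 mulr1.
  by move: (dot s0 s0) (K' s0) dot0 => u v u0; field.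
have [M1 [cM1 M10 ME]] := hadamard oV V0 cM M0.
have N0 : N 0 = 0 by rewrite /N addr0 K0 mulr0 mul0r.
have {}M10 : M1 0 = 0 by rewrite M10 (derive1_val (dM 0 V0)).
have [q [cq q0 M1E]] := hadamard oV V0 cM1 M10.
have qE : K' s0 / dot s0 s0 = 2 * q 0.
  by apply: (double_zero oV V0 cq _ dM dN) => y Vy; rewrite ME// M1E.
have K'0 := K'_neq0 closed_f generic_f K0.
have {}q0 : q 0 != 0.
  apply: contraNneq K'0 => h; move: qE; rewrite h mulr0 => /eqP.
  by rewrite mulf_eq0 invr_eq0 (negbTE dot0) orbF.
pose eps : R := if 0 < q 0 then 1 else -1.
have eps0 : eps != 0 by rewrite /eps; case: ifP => _; rewrite ?oppr_eq0 oner_eq0.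
have pos0 : 0 < eps * q 0.
  rewrite /eps; case: (ltgtP (q 0) 0) q0 => // h _; last by rewrite mul1r.
  by rewrite mulN1r oppr_gt0.
have ceq : Cinf V (fun y => eps * q y) by apply: CinfM => //; exact: Cinf_cst.
have ceq0 : {for 0, continuous (fun y => eps * q y)} by exact: Cinf_continuous ceq V0.
have npos : \forall y \near 0, 0 < eps * q y by exact: (cvgr_gt (eps * q 0) ceq0 _ pos0).
have [d2 d20 P2] := nbhs_oball (filterI npos (oball_nbhs 0 d10)).
pose d := Num.min d2 r.
have d0 : 0 < d by rewrite /d lt_min d20 r0.
have Vd y : oball 0 d y -> 0 < eps * q y /\ V y.
  move=> By; apply: P2; apply/oballP; move/oballP: By; rewrite /d lt_min.
  by case/andP.
have csq : Cinf (oball 0 d) (fun y => Num.sqrt (eps * q y)).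
  apply: Cinf_sqrt; first by move=> y /Vd[].
  by apply: Cinf_sub ceq => y /Vd[].
exists (fun y => y * Num.sqrt (eps * q y)), eps, d; split.
- by split => //; rewrite /d ge_min lexx orbT.
- by apply: CinfM; [exact: Cinf_id|exact: csq].
- have D := is_derM (is_derive_id (0 : R) (1 : R)) (Cinf_is_derive csq (oball_center 0 d0)).
  by rewrite (derive1_val D) mul0r addr0 mul1r sqrtr_gt0.
- move=> y /Vd[py Vy]; split; first exact: dp.
    by exists (Num.sqrt (eps * q y)); rewrite ?sqrtr_gt0.
  rewrite exprMn sqr_sqrtr ?ltW// -/(M y) ME// M1E//; ring.
Qed.

Lemma distinct_small (s t : R) : s != t -> `|s - t| < 1 -> distinct_on_circle s t.
Proof.
move=> st h; apply/negP => /intrP[m E]; move: h; rewrite E -intr_norm ltrz1.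
rewrite -[1]add0r ltzD1 normr_le0 => /eqP m0.
by move: E; rewrite m0 => /subr0_eq /eqP; rewrite (negbTE st).
Qed.

End DiagonalBranch.

(** * The branch through a diagonal point *)

Section DiagonalInflexion.
Context {R : realType}.
Variable f : R -> R * R.
Hypothesis closed_f : closed_smooth_curve f.
Hypothesis generic_f : generic f.
Local Notation K := (wronskian f).
Local Notation K' := (wronskian' f).
Local Notation cross := (tangent_cross f).
Local Notation dot := (tangent_dot f).
Local Notation slope s0 t := (cross s0 t / dot s0 t).

(* h is a fold coordinate at s0 and g its inverse.  The radius r keeps s0 the only
   inflexion in sight, and keeps distinct parameters distinct on the circle. *)
Section Fold.
Variable s0 : R.
Hypothesis K0 : K s0 = 0.
Variables (r eps d e : R) (h g : R -> R) (W : set R).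
Hypothesis r0 : 0 < r.
Hypothesis r2 : r <= 1 / 2.
Hypothesis Kiso : forall x, oball s0 r x -> K x = 0 -> x = s0.
Hypothesis Ksgn : forall x, oball s0 r x ->
  exists2 c, 0 < c & K x * K' s0 = c * (x - s0).
Hypothesis dr : d <= r.
Hypothesis eps0 : eps != 0.
Hypothesis hP : forall y, oball 0 d y ->
    [/\ 0 < dot s0 (s0 + y), (exists2 w, 0 < w & h y = y * w) &
        h y ^+ 2 = eps * slope s0 (s0 + y)].
Hypothesis e0 : 0 < e.
Hypothesis oW : open W.
Hypothesis W0 : W 0.
Hypothesis WU : W `<=` oball 0 d.
Let V := oball (0 : R) e.
Hypothesis cg : Cinf V g.
Hypothesis hK : forall x, W x -> V (h x) /\ g (h x) = x.
Hypothesis gK : forall y, V y -> W (g y) /\ h (g y) = y.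
Hypothesis hpos : forall x, W x -> 0 < derive1 h x.
Hypothesis dg : forall y, V y -> is_derive y 1 g (derive1 h (g y))^-1.

Let h0 : h 0 = 0.
Proof. by have [_ [w _ ->] _] := hP (WU W0); rewrite mul0r. Qed.

Let V0 : V 0. Proof. exact: oball_center. Qed.

Let oV : open V. Proof. exact: open_oball. Qed.

Let g0 : g 0 = 0.
Proof. by have [_ h00] := hK W0; rewrite h0 in h00. Qed.

Let Vopp x : V x -> V (- x).
Proof. by move=> /oballP; rewrite subr0 => ?; apply/oballP; rewrite subr0 normrN. Qed.

Let gsign x : V x -> exists2 w, 0 < w & x = g x * w.
Proof. by move=> /gK[/WU/hP[_ [w w0 E] _] hg]; exists w; rewrite // -E hg. Qed.

Let g'pos x : V x -> 0 < derive1 g x.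
Proof. by move=> Vx; rewrite (derive1_val (dg Vx)) invr_gt0 hpos//; case: (gK Vx). Qed.

Let g_small x : V x -> `|g x| < r.
Proof. by move=> /gK[/WU/oballP + _]; rewrite subr0 => /lt_le_trans; exact. Qed.

Let ball_r x : V x -> oball s0 r (s0 + g x).
Proof. by move=> /g_small ?; apply/oballP; rewrite addrAC subrr add0r. Qed.

(** The slope of the tangent is a function of h^2, so that a pair of distinct
    parallel points has opposite values of h. *)
Definition fold_curve x : R * R := (s0 + g x, s0 + g (- x)).

Let a := fst \o fold_curve.
Let b := snd \o fold_curve.

Let ca : Cinf V a.
Proof. by apply: CinfD; [exact: Cinf_cst|exact: cg]. Qed.

Let cgN : Cinf V (fun x => g (- x)).
Proof. by apply: (Cinf_comp Vopp cg); apply: CinfN; exact: Cinf_id. Qed.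

Let cb : Cinf V b.
Proof. by apply: CinfD; [exact: Cinf_cst|exact: cgN]. Qed.

Let da x : V x -> derive1 a x = derive1 g x.
Proof.
move=> Vx; apply: derive1_val.
by apply: (is_derive_ext (is_derD (is_derive_cst s0 x 1) (Cinf_is_derive cg Vx)));
  rewrite add0r.
Qed.

Let db x : V x -> derive1 b x = - derive1 g (- x).
Proof.
move=> Vx; apply: derive1_val.
have dN : is_derive x (1 : R) (fun y : R => - y) (- 1).
  exact: is_deriveN (is_derive_id x (1 : R)).
have := is_derD (is_derive_cst s0 x 1) (is_der_comp (Cinf_is_derive cg (Vopp Vx)) dN).
by move=> D; apply: (is_derive_ext D); rewrite add0r mulrN1.
Qed.

Let ab0 x : V x -> cross (a x) (b x) = 0.
Proof.
move=> Vx; have [Wx hx] := gK Vx; have [Wy hy] := gK (Vopp Vx).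
have [p1 _ s1] := hP (WU Wx); have [p2 _ s2] := hP (WU Wy).
apply/eqP; rewrite (slope_eq closed_f generic_f p1 p2).
by apply/eqP/(mulfI eps0); rewrite -s1 -s2 hx hy sqrrN.
Qed.

Let g_inj x y : V x -> V y -> g x = g y -> x = y.
Proof. by move=> /gK[_ hx] /gK[_ hy] E; rewrite -hx -hy E. Qed.

Let distinct_ab x : V x -> x != 0 -> distinct_on_circle (a x) (b x).
Proof.
move=> Vx x0; apply: distinct_small.
  apply: contra x0 => /eqP /addrI /(g_inj Vx (Vopp Vx)) E.
  by apply/eqP; lra.
have h1 := g_small Vx; have h2 := g_small (Vopp Vx).
have -> : a x - b x = g x - g (- x).
  by rewrite /a /b /= opprD addrACA subrr add0r.
have h3 := ler_normB (g x) (g (- x)); apply: (le_lt_trans h3).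
by move: r2 h1 h2; move: (`|g x|) (`|g (- x)|) => u v; lra.
Qed.

Let cont_fold x : V x -> {for x, continuous fold_curve}.
Proof.
move=> Vx; have c1 := Cinf_continuous ca Vx; have c2 := Cinf_continuous cb Vx.
exact: (cvg_pair (F := nbhs x) (G := nbhs (a x)) (H := nbhs (b x)) c1 c2).
Qed.

Let Sigma_fold x : V x -> Sigma f (fold_curve x).
Proof.
have S y : V y -> y != 0 -> [set p | distinct_on_circle p.1 p.2 /\
                   det2 (f^`() p.1) (f^`() p.2) = 0] (fold_curve y).
  by move=> Vy y0; split; [exact: distinct_ab|rewrite (crossE closed_f); exact: ab0].
move=> Vx; have [->|x0] := eqVneq x 0; last by apply: subset_closure; exact: S.
move=> B nB; have nV : nbhs (0 : R) V by exact: oball_nbhs.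
have [d1 d10 P] := nbhs_oball (filterI nV (cont_fold V0 nB)).
have [Vy By] : V (d1 / 2) /\ B (fold_curve (d1 / 2)).
  by apply: P; apply/andP; split; lra.
exists (fold_curve (d1 / 2)); split => //; apply: S => //.
by rewrite gt_eqF// divr_gt0.
Qed.

Lemma fold_local_parameterization : local_parameterization f (s0, s0) fold_curve.
Proof.
have UE : [set x : R | - e < x < e] = V.
  by apply/seteqP; split=> x; rewrite /V /oball /= sub0r add0r.
have f0 : fold_curve 0 = (s0, s0) by rewrite /fold_curve oppr0 g0 addr0.
split; first exact: f0.
exists e; first exact: e0.
cbv zeta; rewrite UE; split.
- by apply/(smooth_on_plane _ oV); split; [exact: ca|exact: cb].
- move=> x Vx; rewrite (derive1_pair oV ca cb Vx) -/a -/b (da Vx).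
  by apply/negP => /eqP[E _]; have := g'pos Vx; rewrite E ltxx.
- by move=> x y /set_mem Vx /set_mem Vy [/addrI E _]; exact: g_inj E.
pose T1 := [set p : R * R | W (p.1 - s0)]; pose T2 := [set p : R * R | W (p.2 - s0)].
have oT1 : open T1.
  apply: (@open_comp _ _ (fun p : R * R => p.1 - s0)) => // p _.
  by apply: continuousB; [exact: (@continuous_fst R R R p)|exact: cvg_cst].
have oT2 : open T2.
  apply: (@open_comp _ _ (fun p : R * R => p.2 - s0)) => // p _.
  by apply: continuousB; [exact: (@continuous_snd R R R p)|exact: cvg_cst].
exists (T1 `&` T2); first exact: openI.
apply/seteqP; split; last first.
  move=> _ [x Vx <-]; split.
    have img : fold_curve @` V `<=` connected_component (Sigma f) (s0, s0).
      apply: connected_component_max.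
      - by exists 0.
      - by move=> _ [y Vy <-]; exact: Sigma_fold.
      - apply: connected_continuous_connected.
          apply/connected_intervalP => u v Vu Vv z uzv; exact: oball_sub Vu Vv uzv.
        by apply: continuous_in_subspaceT => y /set_mem Vy; exact: cont_fold.
    by apply: img; exists x.
  split; rewrite /T1 /T2 /= addrAC subrr add0r.
    by have [] := gK Vx.
  by have [] := gK (Vopp Vx).
move=> q [/connected_component_sub Sq [W1 W2]]; rewrite /T1 /T2 /= in W1 W2.
have cq := Sigma_cross closed_f Sq.
have sh t : s0 + (t - s0) = t by rewrite addrC subrK.
have [p1 _ s1] := hP (WU W1); have [p2 _ s2] := hP (WU W2).
rewrite !sh in p1 s1 p2 s2.
move/eqP: cq; rewrite (slope_eq closed_f generic_f p1 p2) => /eqP cq.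
have /eqP : h (q.1 - s0) ^+ 2 = h (q.2 - s0) ^+ 2 by rewrite s1 s2 cq.
have [V1 g1] := hK W1; have [V2 g2] := hK W2.
rewrite eqf_sqr => /orP[/eqP E|/eqP E].
  have y12 : q.1 - s0 = q.2 - s0 by rewrite -g1 -g2 E.
  have q12 : q.1 = q.2 by rewrite -(sh q.1) -(sh q.2) y12.
  have ndq : ~ distinct_on_circle q.1 q.2.
    by rewrite q12 /distinct_on_circle subrr; apply/negP; rewrite negbK int_num0.
  have Kq := Sigma_diagonal closed_f generic_f Sq ndq.
  have Bq : oball s0 r q.1 by have := ball_r V1; rewrite g1 sh.
  exists 0; first exact: V0.
  have q1 := Kiso Bq Kq; rewrite f0; apply: pair_ext => /=; first by rewrite q1.
  by rewrite -q12 q1.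
exists (h (q.1 - s0)); first exact: V1.
apply: pair_ext => /=; first by rewrite g1 sh.
by rewrite E opprK g2 sh.
Qed.

(** By curvature_secant the curvature of the branch has the sign of b' K(b), where
    b' < 0, and b passes s0 at x = 0, where K changes sign. *)
Lemma fold_inflexion : branch_inflexion f (s0, s0).
Proof.
split.
  by have := Sigma_fold V0; rewrite /fold_curve oppr0 g0 addr0.
exists fold_curve; first exact: fold_local_parameterization.
have a0 : a 0 = s0 by rewrite /a /= g0 addr0.
have b0 : b 0 = s0 by rewrite /b /= oppr0 g0 addr0.
have la0 : 0 < secant_speed f a b 0.
  rewrite /secant_speed /ratio a0 b0 divff; last first.
    exact: lt0r_neq0 (dot_gt0 closed_f generic_f s0).
  by rewrite mul1r (da V0) (db V0) opprK oppr0 addr_gt0// g'pos.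
have fE : fold_curve 0 = (s0, s0) by rewrite /fold_curve oppr0 g0 addr0.
split.
  apply/eqP => /(secant_stationaryP closed_f generic_f e0 ca cb Sigma_fold).
  by move=> E; move: la0; rewrite E ltxx.
have cla : {for 0, continuous (secant_speed f a b)}.
  exact: Cinf_continuous (secant_speed_smooth closed_f generic_f oV ca cb) V0.
have nla : \forall x \near 0, 0 < secant_speed f a b x.
  exact: (cvgr_gt (secant_speed f a b 0) cla _ la0).
have kE x : V x -> 0 < secant_speed f a b x ->
    exists2 C, 0 < C & curvature (secant f \o fold_curve) x * K' s0 = C * x.
  move=> Vx lx; have Vy := Vopp Vx.
  have [C C0 ->] := curvature_secant closed_f generic_f oV ca cb ab0 Vx (lt0r_neq0 lx).
  have [c c0 Ec] := Ksgn (ball_r Vy); have [w w0 Ew] := gsign Vy.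
  exists (C * derive1 g (- x) * c / w).
    by rewrite divr_gt0// !mulr_gt0// g'pos.
  rewrite (db Vx) [b x]/(s0 + g (- x)).
  have gw : g (- x) = - x / w by rewrite [in RHS]Ew mulfK// gt_eqF.
  rewrite [X in c * X]addrAC subrr add0r [X in c * X]gw in Ec.
  move: (derive1 g (- x)) (K (s0 + g (- x))) (K' s0) Ec => u k k' Ec.
  have -> : C * (- u * k) * k' = - (C * u) * (k * k') by ring.
  by rewrite Ec; field; exact: lt0r_neq0.
have nV := oball_nbhs 0 e0.
have n := filterI nV nla.
have nl : \forall x \near 0^'-, x < 0 /\ (V x /\ 0 < secant_speed f a b x).
  by near=> x; split; [near: x; exact: nbhs_left_lt|near: x; apply: cvg_within; exact: n].
have nr : \forall x \near 0^'+, 0 < x /\ (V x /\ 0 < secant_speed f a b x).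
  by near=> x; split; [near: x; exact: nbhs_right_gt|near: x; apply: cvg_within; exact: n].
have K'0 := K'_neq0 closed_f generic_f K0.
have [kp|kn] : 0 < K' s0 \/ K' s0 < 0.
  by case: (ltgtP (K' s0) 0) K'0 => // u _; [right|left].
  left; split.
    apply: filterS nl => x [x0 [Vx lx]]; have [C C0 E] := kE x Vx lx.
    by rewrite -(pmulr_llt0 _ kp) E pmulr_rlt0.
  apply: filterS nr => x [x0 [Vx lx]]; have [C C0 E] := kE x Vx lx.
  by rewrite -(pmulr_lgt0 _ kp) E mulr_gt0.
right; split.
  apply: filterS nl => x [x0 [Vx lx]]; have [C C0 E] := kE x Vx lx.
  by rewrite -(nmulr_llt0 _ kn) E pmulr_rlt0.
apply: filterS nr => x [x0 [Vx lx]]; have [C C0 E] := kE x Vx lx.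
by rewrite -(nmulr_lgt0 _ kn) E mulr_gt0.
Unshelve. all: by end_near. Qed.

End Fold.

Lemma diagonal_branch_inflexion s0 : K s0 = 0 -> branch_inflexion f (s0, s0).
Proof.
move=> K0; have [d1 d10 P1] := K_isolated closed_f generic_f s0.
have [d2 d20 P2] := K_sign closed_f generic_f K0.
pose r := Num.min (1 / 2) (Num.min d1 d2).
have r0 : 0 < r by rewrite /r !lt_min d10 d20 divr_gt0.
have r2 : r <= 1 / 2 by rewrite /r ge_min lexx.
have sub x : oball s0 r x -> oball s0 d1 x /\ oball s0 d2 x.
  move=> /oballP; rewrite /r !lt_min => /and3P[_ ? ?].
  by split; apply/oballP.
have [h [eps [d [[d0 dr eps0] ch h'0 hP]]]] := fold_coordinate closed_f generic_f K0 r0.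
have [g [e [W [e0 oW W0 WU [cg hK gK hpos dg]]]]] :=
  inverse_function (@open_oball R 0 d) (oball_center 0 d0) ch h'0.
have h0 : h 0 = 0 by have [_ [w _ ->] _] := hP 0 (oball_center 0 d0); rewrite mul0r.
rewrite h0 in cg hK gK dg.
have Kiso x : oball s0 r x -> K x = 0 -> x = s0 by move=> /sub[B1 _]; exact: P1.
have Ksgn x : oball s0 r x -> exists2 c, 0 < c & K x * K' s0 = c * (x - s0).
  by move=> /sub[_ B2]; exact: P2.
exact: (fold_inflexion K0 r2 Kiso Ksgn dr eps0 hP e0 oW W0 WU cg hK gK hpos dg).
Qed.

End DiagonalInflexion.

(** * Parity *)

Section Parity.
Context {R : realType}.
Variable f : R -> R * R.
Hypothesis closed_f : closed_smooth_curve f.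
Hypothesis generic_f : generic f.
Local Notation K := (wronskian f).
Local Notation K' := (wronskian' f).

Lemma torus_distinct (s t : R) : 0 <= s < 1 -> 0 <= t < 1 -> s != t ->
  distinct_on_circle s t.
Proof.
move=> /andP[s0 s1] /andP[t0 t1] st; apply: distinct_small => //.
by rewrite ltr_norml; apply/andP; split; lra.
Qed.

Lemma finite_diagonal_inflexions :
  finite_set [set p : R * R | [/\ 0 <= p.1 < 1, 0 <= p.2 < 1 &
                                  p.1 = p.2 /\ K p.1 = 0]].
Proof.
apply: (@finite_of_isolated R [set p | p.1 = p.2 /\ K p.1 = 0]) => p.
have [d1 d10 P1] := K_isolated closed_f generic_f p.1.
have [d2 d20 P2] := K_isolated closed_f generic_f p.2.
have n1 := near_fst (oball_nbhs p.1 d10); have n2 := near_snd (oball_nbhs p.2 d20).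
near=> q => -[q12 Kq].
have B1 : oball p.1 d1 q.1 by near: q.
have B2 : oball p.2 d2 q.2 by near: q.
apply: pair_ext; first exact: P1 B1 Kq.
by apply: P2 B2 _; rewrite -q12.
Unshelve. all: by end_near. Qed.

Lemma finite_SC_cusps : finite_set (SC_cusps f).
Proof.
apply: (sub_finite_set _ (finite_of_isolated (singular_pairs_isolated closed_f generic_f))).
move=> p [p1 p2 cp]; split => //; apply: cusp_singular => //.
apply: torus_distinct => //; apply/eqP => E.
exact: (diagonal_not_cusp closed_f generic_f E cp).
Qed.

Lemma finite_SC_inflexions : finite_set (SC_inflexions f).
Proof.
have fin1 := finite_of_isolated (inflexion_pairs_isolated closed_f generic_f).
have fin2 := finite_diagonal_inflexions.
have fin : finite_set ([set p : R * R | [/\ 0 <= p.1 < 1, 0 <= p.2 < 1 & inflexion_pairs f p]]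
  `|` [set p : R * R | [/\ 0 <= p.1 < 1, 0 <= p.2 < 1 & p.1 = p.2 /\ K p.1 = 0]]).
  by rewrite finite_setU.
apply: (sub_finite_set _ fin) => p [p1 p2 ip].
have [E|ne] := eqVneq p.1 p.2.
  right; split => //; split => //; have [Sp _] := ip.
  apply: (Sigma_diagonal closed_f generic_f Sp).
  by rewrite E /distinct_on_circle subrr; apply/negP; rewrite negbK int_num0.
left; split => //; apply: inflexion_pair_of_branch => //.
exact: torus_distinct.
Qed.

Lemma even_SC_cusps : finite_even (SC_cusps f).
Proof.
have fin := finite_SC_cusps; split => //; apply: even_swap => p.
  rewrite !in_fset_set// !inE => -[p1 p2 cp]; split => //.
  exact: branch_cusp_swap.
rewrite in_fset_set// inE => -[_ _ cp]; apply/eqP => E.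
exact: (diagonal_not_cusp closed_f generic_f E cp).
Qed.

Lemma diagonal_inflexionP (p : R * R) : p.1 = p.2 ->
  branch_inflexion f p <-> K p.1 = 0.
Proof.
case: p => s t /= <-; split=> [[Ss _]|]; last exact: diagonal_branch_inflexion.
apply: (Sigma_diagonal closed_f generic_f Ss).
by rewrite /distinct_on_circle subrr; apply/negP; rewrite negbK int_num0.
Qed.

Lemma even_SC_inflexions : finite_even (SC_inflexions f).
Proof.
have fin := finite_SC_inflexions; split => //.
set F := fset_set (SC_inflexions f).
have FP p : p \in F <-> SC_inflexions f p by rewrite /F in_fset_set// inE.
pose F1 := [fset p in F | p.1 != p.2]%fset.
pose F2 := [fset p in F | p.1 == p.2]%fset.
have -> : F = (F1 `|` F2)%fset.
  by apply/fsetP => p; rewrite !inE /=; case: (p \in F) => //=; case: eqP.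
rewrite cardfsU (_ : (F1 `&` F2)%fset = fset0) ?cardfs0 ?subn0; last first.
  by apply/fsetP => p; rewrite !inE /=; case: eqP; rewrite ?andbF.
rewrite oddD; have /negbTE -> : ~~ odd #|` F1|.
  apply: even_swap => p; rewrite !inE /= => /andP[pF p12]; last exact: p12.
  rewrite eq_sym p12 andbT; apply/FP; have [p1 p2 ip] := (FP p).1 pF.
  by split => //; exact: branch_inflexion_swap.
rewrite addFb; pose Z := [fset p.1 | p in F2]%fset.
have -> : #|` F2| = #|` Z|.
  rewrite [RHS]card_in_imfset// => p q; rewrite !inE /=.
  move=> /andP[_ /eqP p12] /andP[_ /eqP q12] E.
  by apply: pair_ext; rewrite // -p12 -q12.
apply: (@even_periodic_zeros R K K').
- by move=> t; exact: Cinf_continuous (smooth_K closed_f) (Logic.I : setT t).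
- by move=> t; exact: (K_int closed_f 1).
- move=> t; exact: (K'_int closed_f 1).
- by move=> z Kz; exact: (K_sign closed_f generic_f Kz).
move=> x; split=> [/imfsetP[p /=]|[x01 Kx]].
  rewrite !inE => /andP[/FP[p1 _ ip] /eqP E] ->; split => //.
  exact: (diagonal_inflexionP E).1.
apply/imfsetP; exists (x, x) => //=; rewrite !inE /= eqxx andbT; apply/FP.
by split => //; apply/diagonal_inflexionP.
Qed.

End Parity.

Theorem corollary2p17 (R : realType) (f : R -> R * R)
    (closed_f : closed_smooth_curve f) (generic_f : generic f) :
  finite_even (SC_cusps f) /\ finite_even (SC_inflexions f).
Proof. by split; [exact: even_SC_cusps|exact: even_SC_inflexions]. Qed.
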